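(* Let $z\in\mathcal{C}^2(\mathbb{R}^2)$ satisfy $z_y(x,y)\neq 0$ for every $(x,y)\neq(0,0)$, and for $A,B\subset\mathbb{R}$ put $$P(A,B):=\{(x,z(x,y)) : x\in A,\ y\in B\}\subset\mathbb{R}^2 .$$ Let $A,B\subset\mathbb{R}$ be bounded sets such that at least one of the following holds: (i) $A$ and $B$ both have positive Lebesgue measure; (ii) $A$ and $B$ are Cantor sets with $\tau(A)\cdot\tau(B)>1$, where $\tau$ denotes Newhouse thickness; (iii) $A$ and $B$ are sets of second Baire category and $B$ is a Baire set; (iv) there exists a non-degenerate interval $J_1$ such that $\#(J_1\setminus A)=\aleph_0$ and $\#B=\aleph$ (the cardinality of the continuum). Let $\Gamma\subset\mathbb{R}^2$ be a set which contains a $\mathcal{C}^2$ sub-curve with non-vanishing curvature. Then the interior of the arithmetic sum $P(A,B)+\Gamma=\{p+q: p\in P(A,B), q\in\Gamma\}$ is non-empty.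
   Context: A Cantor set is a non-empty compact, perfect, totally disconnected subset of $\mathbb{R}$. Newhouse thickness: for a Cantor set $K$, its gaps are the bounded connected components of $\mathbb{R}\setminus K$. If $u$ is the right endpoint of a gap $G$, let $\widetilde G$ be the first gap to the right of $u$ with $|\widetilde G|\ge |G|$ and let the bridge be $B(u)=(u,\ell(\widetilde G))$, where $\ell(\widetilde G)$ is the left endpoint of $\widetilde G$ (if no such gap exists, the bridge extends to $\max K$); bridges at left endpoints of gaps are defined symmetrically. Then $\tau(K)=\inf_u |B(u)|/|G|$, the infimum over all gap endpoints $u$ (with $G$ the gap of which $u$ is an endpoint). A set is of first category if it is a countable union of nowhere dense sets, and of second category otherwise. A Baire set is a set of the form $E\triangle M$ with $E$ open and $M$ of first category. *)

(* Defs.v *)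
From mathcomp Require Import all_boot all_order all_algebra.
From mathcomp Require Import all_classical all_reals all_analysis.
Import Order.TTheory GRing.Theory Num.Theory.
Import numFieldNormedType.Exports.
Local Open Scope classical_set_scope.
Local Open Scope ring_scope.

Definition Rbounded (R : realType) (A : set R) : Prop :=
  exists M : R, forall x, A x -> `|x| <= M.

Definition lebesgue_measurable (R : realType) (A : set R) : Prop :=
  measurable (A : set (caratheodory_type (R:=R) (@wlength R idfun)^*%mu)).

Definition positive_lebesgue_measure (R : realType) (A : set R) : Prop :=
  lebesgue_measurable R A /\
  (0 < completed_lebesgue_measure
         (A : set (caratheodory_type (R:=R) (@wlength R idfun)^*%mu)))%E.

Definition cantor_set (R : realType) (K : set R) : Prop :=
  K !=set0 /\ compact K /\ perfect_set K /\ totally_disconnected K.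

(* (a,b) is a gap of K: a bounded connected component of R \ K
   (for closed K these are exactly the open intervals (a,b), a<b,
   disjoint from K with both endpoints in K). *)
Definition is_gap (R : realType) (K : set R) (a b : R) : Prop :=
  a < b /\ K a /\ K b /\ (forall x, a < x -> x < b -> ~ K x).

Definition right_bridge_length (R : realType) (K : set R) (a b L : R) : Prop :=
  (exists c d, [/\ is_gap R K c d, b <= c, b - a <= d - c, L = c - b &
      forall c' d', is_gap R K c' d' -> b <= c' -> b - a <= d' - c' -> c <= c'])
  \/
  ((forall c d, is_gap R K c d -> b <= c -> d - c < b - a) /\ L = sup K - b).

Definition left_bridge_length (R : realType) (K : set R) (a b L : R) : Prop :=
  (exists c d, [/\ is_gap R K c d, d <= a, b - a <= d - c, L = a - d &
      forall c' d', is_gap R K c' d' -> d' <= a -> b - a <= d' - c' -> d' <= d])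
  \/
  ((forall c d, is_gap R K c d -> d <= a -> d - c < b - a) /\ L = a - inf K).

Definition thickness (R : realType) (K : set R) : R :=
  inf [set r : R | exists a b L, is_gap R K a b /\
         (right_bridge_length R K a b L \/ left_bridge_length R K a b L) /\
         r = L / (b - a)].

Definition nowhere_dense (R : realType) (S : set R) : Prop :=
  interior (closure S) = set0.

Definition first_category (R : realType) (S : set R) : Prop :=
  exists F : nat -> set R, (forall n, nowhere_dense R (F n)) /\
    S = \bigcup_n F n.

Definition second_category (R : realType) (S : set R) : Prop :=
  ~ first_category R S.

Definition baire_set (R : realType) (S : set R) : Prop :=
  exists E M : set R, open E /\ first_category R M /\
    S = (E `\` M) `|` (M `\` E).

Definition nondegenerate_interval (R : realType) (J : set R) : Prop :=
  (forall x y w, J x -> J w -> x <= y -> y <= w -> J y) /\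
  (exists x y, J x /\ J y /\ x < y).

Definition pdx (R : realType) (f : R -> R -> R) : R -> R -> R :=
  fun x y => derive1 (fun s => f s y) x.
Definition pdy (R : realType) (f : R -> R -> R) : R -> R -> R :=
  fun x y => derive1 (fun t => f x t) y.

Definition has_partials (R : realType) (f : R -> R -> R) : Prop :=
  forall x y, derivable (fun s => f s y) x 1 /\ derivable (fun t => f x t) y 1.

Definition jcont (R : realType) (f : R -> R -> R) : Prop :=
  continuous (fun p : R * R => f p.1 p.2).

Definition C2_plane (R : realType) (f : R -> R -> R) : Prop :=
  has_partials R f /\ has_partials R (pdx R f) /\ has_partials R (pdy R f) /\
  jcont R f /\ jcont R (pdx R f) /\ jcont R (pdy R f) /\
  jcont R (pdx R (pdx R f)) /\ jcont R (pdy R (pdx R f)) /\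
  jcont R (pdx R (pdy R f)) /\ jcont R (pdy R (pdy R f)).

Definition contains_C2_curve_nonvanishing_curvature (R : realType)
    (G : set (R * R)) : Prop :=
  exists (t0 t1 : R) (g1 g2 : R -> R), t0 < t1 /\
    forall t, t0 < t -> t < t1 ->
      derivable g1 t 1 /\ derivable g2 t 1 /\
      derivable (derive1 g1) t 1 /\ derivable (derive1 g2) t 1 /\
      {for t, continuous (derive1 (derive1 g1))} /\
      {for t, continuous (derive1 (derive1 g2))} /\
      (derive1 g1 t, derive1 g2 t) <> (0, 0) /\
      derive1 g1 t * derive1 (derive1 g2) t
        - derive1 g2 t * derive1 (derive1 g1) t != 0 /\
      G (g1 t, g2 t).

Definition Pset (R : realType) (z : R -> R -> R) (A B : set R) : set (R * R) :=
  [set p | exists x y, A x /\ B y /\ p = (x, z x y)].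

Definition plane_sum (R : realType) (S T : set (R * R)) : set (R * R) :=
  [set w | exists p q, S p /\ T q /\ w = (p.1 + q.1, p.2 + q.2)].

(* Main.v *)
Require Import Defs.
From mathcomp Require Import all_boot all_order all_algebra.
From mathcomp Require Import all_classical all_reals all_analysis.
From mathcomp Require Import ring lra.
Import Order.TTheory GRing.Theory Num.Theory.
Import numFieldNormedType.Exports.
Local Open Scope classical_set_scope.
Local Open Scope card_scope.
Local Open Scope ring_scope.

                                                                                     
                                                                                                
                                                                                            
                                                                                            
                                                                                          
                                                                                             
                                                                                       
                                                                                                   
                                                                                        
                                                              

(** Write the curve as [(g1 t, g2 t)]. A point [w] lies in the sum as soon as some [x] in [A], [y]
    in [B] and [t] satisfy [w = (x + g1 t, z x y + g2 t)]. For [x] near [x0] the first coordinate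
    determines [t] and the second then determines [y], so the solutions form the graph of a function
    [h] depending on [w], and [w] is in the sum when this graph meets [A * B]. By linearisation
    every such [h] is close to affine, with slope [m = (g2' / g1' - z_x) / z_y] up to an arbitrarily
    small Lipschitz error [eta]; this is the notion [near_affine_on], and [local_graphs] is the
    construction of [h]. When [w] moves a little, [h] keeps its slope bounds and moves a little at a
    chosen point [x1].

    The interior is therefore non-empty if meeting [A * B] is stable: all functions of approximate
    slope [m] that pass close to a well-chosen point [(x1, y1)] must hit [A * B] near [(x0, y0)].
    This property is [graph_stable], and [graph_stable_interior] turns it into an open set of sums.
    Curvature enters only there: the tangent direction turns, so some parameter has [g1' != 0] and
    [m != 0]. The base point is chosen with [y0 != 0], hence away from the origin, so that
    [z_y != 0].

    It remains to prove [graph_stable] in the four cases. For positive measure, take density points: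
    [h] is bi-Lipschitz and cannot carry most of an interval into the small complement of [B]. For
    category, preimages of meagre sets under [h] are meagre, while [A] is non-meagre near [x0] and
    [B] is residual near [y0]. For a co-countable [A], a missed [B] would be locally inside the
    countable image of the exceptional set. For Cantor sets, [gap_lemma] is a form of Newhouse's gap
    lemma for an increasing map with slopes in a narrow range, a loss that the strict inequality on
    the thicknesses absorbs. *)

Definition near_affine_on {R : realType} (D : set R) (m eta : R) (f : R -> R) :=
  forall x x', D x -> D x' -> `|f x' - f x - m * (x' - x)| <= eta * `|x' - x|.

(** * Functions that are affine up to a small Lipschitz error *)

Section NearAffine.
Context {R : realType}.
Implicit Types (D : set R) (m eta c r v x y : R) (f h : R -> R).

Lemma near_affine_onN D m eta f :
  near_affine_on D m eta f -> near_affine_on D (- m) eta (fun x => - f x).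
Proof.
move=> hf x x' Dx Dx'; rewrite -normrN; apply: le_trans (hf x x' Dx Dx').
by rewrite le_eqVlt; apply/orP; left; apply/eqP; congr (`|_|); ring.
Qed.

Lemma near_affine_on_sub (D D' : set R) m eta f : D' `<=` D ->
  near_affine_on D m eta f -> near_affine_on D' m eta f.
Proof. by move=> sD hf x x' /sD Dx /sD Dx'; exact: hf. Qed.

Lemma near_affine_on_le D m eta f x x' : near_affine_on D m eta f ->
  D x -> D x' -> `|f x' - f x| <= (`|m| + eta) * `|x' - x|.
Proof.
move=> hf Dx Dx'; have := hf _ _ Dx Dx'.
rewrite mulrDl -normrM => h1.
rewrite -[f x' - f x](subrK (m * (x' - x))) addrC.
by apply: le_trans (ler_normD _ _) _; rewrite lerD2l.
Qed.

Lemma near_affine_on_ge D m eta f x x' : near_affine_on D m eta f ->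
  D x -> D x' -> (`|m| - eta) * `|x' - x| <= `|f x' - f x|.
Proof.
move=> hf Dx Dx'; have := hf _ _ Dx Dx'.
rewrite mulrBl -normrM distrC => h1.
rewrite lerBlDr -[X in `|X| <= _](subrK (f x' - f x)) addrC.
by apply: le_trans (ler_normD _ _) _; rewrite lerD2l.
Qed.

Lemma near_affine_on_lt {D m eta f x x'} : near_affine_on D m eta f ->
  D x -> D x' -> x <= x' ->
  (m - eta) * (x' - x) <= f x' - f x <= (m + eta) * (x' - x).
Proof.
move=> hf Dx Dx' xx'; have := hf _ _ Dx Dx'.
have d0 : 0 <= x' - x by rewrite subr_ge0.
rewrite (ger0_norm d0) ler_norml => /andP[h1 h2].
by apply/andP; split; lra.
Qed.

Lemma near_affine_within_continuous D m eta f (a b : R) :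
  near_affine_on D m eta f -> 0 < eta -> `[a, b]%classic `<=` D ->
  {within `[a, b], continuous f}.
Proof.
move=> hf eta0 abD; apply/subspace_continuousP => x xab.
apply/cvgrPdist_le => e e0.
have L0 : 0 < `|m| + eta by rewrite ltr_wpDl.
rewrite near_withinE; apply/nbhs_ballP; exists (e / (`|m| + eta)) => [|y].
  by rewrite /= divr_gt0.
rewrite /ball/= => /ltW xy yab.
apply: le_trans (near_affine_on_le _ _ _ _ _ _ hf (abD _ yab) (abD _ xab)) _.
by rewrite mulrC -ler_pdivlMr.
Qed.

(** Intermediate values: the increments towards the two ends of the interval are at least
    [(m - eta) * r] when [m] is non-negative, and the other sign follows by passing to [- f]. *)
Lemma near_affine_onto m eta f c r v :
  near_affine_on [set x | `|x - c| <= r] m eta f -> 0 < eta -> 0 <= r ->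
  `|v - f c| <= (`|m| - eta) * r -> exists2 u, `|u - c| <= r & f u = v.
Proof.
wlog m0 : m f v / 0 <= m => [H|].
  have [m0|m0] := leP 0 m; first exact: H.
  move=> /near_affine_onN hf eta0 r0 vb.
  have [||//|//||u uc /oppr_inj fu] := H (- m) (fun x => - f x) (- v).
  - by rewrite oppr_ge0 ltW.
  - exact: hf.
  - by rewrite normrN -opprD normrN.
  - by exists u.
move=> hf eta0 r0; rewrite (ger0_norm m0) ler_norml => /andP[vb1 vb2].
have Dc : [set x | `|x - c| <= r] c by rewrite /= subrr normr0.
have Dl : [set x | `|x - c| <= r] (c - r).
  by rewrite /= addrAC subrr add0r normrN ger0_norm.
have Dr : [set x | `|x - c| <= r] (c + r).
  by rewrite /= addrAC subrr add0r ger0_norm.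
have sub : `[c - r, c + r]%classic `<=` [set x | `|x - c| <= r].
  by move=> x /=; rewrite in_itv/= ler_distl.
have lc : c - r <= c by rewrite gerBl.
have cr : c <= c + r by rewrite lerDl.
have /andP[h1 _] := near_affine_on_lt hf Dl Dc lc.
have /andP[h2 _] := near_affine_on_lt hf Dc Dr cr.
have lr : c - r <= c + r by exact: le_trans lc cr.
have [||u ur fu] := @IVT R f (c - r) (c + r) v lr.
- exact: near_affine_within_continuous hf eta0 sub.
- rewrite ge_min le_max; apply/andP; split; apply/orP; [left|right]; lra.
- by exists u => //; move: ur; rewrite in_itv/= -ler_distl.
Qed.

Lemma near_affine_continuous m eta f : near_affine_on setT m eta f -> 0 < eta ->
  continuous f.
Proof.
move=> hf eta0 x.
have := near_affine_within_continuous setT m eta f (x - 1) (x + 1) hf eta0 (@subsetT _ _).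
move/continuous_within_itvP => [|+ _ _]; first by lra.
by apply; rewrite in_itv/=; apply/andP; split; lra.
Qed.

Lemma near_affine_inverse m eta f : near_affine_on setT m eta f ->
  0 < eta -> eta < `|m| ->
  exists g, [/\ cancel f g, cancel g f &
     forall y y', `|g y' - g y| <= `|y' - y| / (`|m| - eta)].
Proof.
move=> hf eta0 em.
have k0 : 0 < `|m| - eta by rewrite subr_gt0.
have onto v : exists u, f u = v.
  have [||||u _ fu] := near_affine_onto m eta f 0 (`|v - f 0| / (`|m| - eta)) v.
  - by move=> x x' _ _; exact: hf.
  - by [].
  - by rewrite divr_ge0// ltW.
  - by rewrite mulrC divfK// gt_eqF.
  - by exists u.
have [g gK] := choice onto.
exists g; split => // [x|y y'].
  have := near_affine_on_ge _ _ _ _ x (g (f x)) hf I I.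
  rewrite gK subrr normr0 pmulr_rle0// normr_le0 subr_eq0 => /eqP //.
rewrite ler_pdivlMr// mulrC.
by have := near_affine_on_ge _ _ _ _ (g y) (g y') hf I I; rewrite !gK.
Qed.

End NearAffine.

(** * Linearisation of the data and slope of the implicit function *)

Section Chart.
Context {R : realType}.

Lemma near_affine_derivable (f : R -> R) (c r p e : R) :
  (forall x, `|x - c| <= r -> derivable f x 1 /\ `|derive1 f x - p| <= e) ->
  near_affine_on [set x | `|x - c| <= r] p e f.
Proof.
move=> hf x x' /=.
wlog xx' : x x' / x <= x' => [H Dx Dx'|Dx Dx'].
  have [|/ltW] := leP x x'; first by move=> ?; exact: H.
  move=> x'x; rewrite (distrC x' x); apply: le_trans _ (H _ _ x'x Dx' Dx).
  rewrite le_eqVlt; apply/orP; left; apply/eqP.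
  by rewrite -normrN; congr (`|_|); ring.
have Dy y : x <= y <= x' -> `|y - c| <= r.
  move: Dx Dx'; rewrite !ler_distl => /andP[? ?] /andP[? ?] /andP[? ?].
  by apply/andP; split; lra.
have [||xi] := @MVT_segment R f (derive1 f) x x' xx'.
- move=> y; rewrite in_itv/= => /andP[xy yx'].
  have [|df _] := hf y; first by apply: Dy; rewrite !ltW.
  by rewrite derive1E; exact: derivableP.
- apply: derivable_within_continuous => y; rewrite in_itv/= => yx.
  by have [|df _] := hf y; first exact: Dy.
rewrite in_itv/= => /Dy /hf[_ hxi] ->.
by rewrite -mulrBl normrM ler_wpM2r.
Qed.

Lemma near_affine_C1 (f : R -> R) (c r0 e : R) : 0 < r0 -> 0 < e ->
  (forall x, `|x - c| <= r0 -> derivable f x 1) -> {for c, continuous (derive1 f)} ->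
  exists2 r : R, 0 < r <= r0 & near_affine_on [set x | `|x - c| <= r] (derive1 f c) e f.
Proof.
move=> r00 e0 df /cvgrPdist_le/(_ e e0)/nbhs_ballP[d /= d0 hd].
have m0 : 0 < Num.min (d / 2) r0 by rewrite lt_min divr_gt0.
exists (Num.min (d / 2) r0); first by rewrite m0 ge_min lexx orbT.
apply: near_affine_derivable => x; rewrite le_min => /andP[xd xr].
split; first exact: df.
rewrite distrC; apply: hd; rewrite /ball/= distrC.
by apply: le_lt_trans xd _; lra.
Qed.

Lemma jcont_box (f : R -> R -> R) x0 y0 (e : R) : jcont R f -> 0 < e ->
  exists2 r : R, 0 < r & forall x y : R, `|x - x0| <= r -> `|y - y0| <= r ->
    `|f x y - f x0 y0| <= e.
Proof.
move=> cf e0; have := cf (x0, y0); move=> /cvgrPdist_le/(_ e e0)/nbhs_ballP[d /= d0 hd].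
exists (d / 2); first by rewrite divr_gt0.
move=> x y xd yd; rewrite distrC; apply: (hd (x, y)).
by split; rewrite /ball/= distrC; apply: (@le_lt_trans _ _ (d / 2)) => //; lra.
Qed.

Lemma C2_plane_near_affine (z : R -> R -> R) x0 y0 (e : R) : C2_plane R z -> 0 < e ->
  exists2 r : R, 0 < r & forall x x' y y' : R,
    `|x - x0| <= r -> `|x' - x0| <= r -> `|y - y0| <= r -> `|y' - y0| <= r ->
    `|z x' y' - z x y - pdx R z x0 y0 * (x' - x) - pdy R z x0 y0 * (y' - y)|
      <= e * (`|x' - x| + `|y' - y|).
Proof.
move=> [hp [_ [_ [_ [cx [cy _]]]]]] e0.
have [r1 r10 h1] := jcont_box _ x0 y0 e cx e0.
have [r2 r20 h2] := jcont_box _ x0 y0 e cy e0.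
have m0 : 0 < Num.min r1 r2 by rewrite lt_min r10.
exists (Num.min r1 r2) => // x x' y y'; rewrite !le_min.
move=> /andP[x1 x2] /andP[x'1 x'2] /andP[y1 y2] /andP[y'1 y'2].
have hx : near_affine_on [set x | `|x - x0| <= r1] (pdx R z x0 y0) e (fun s => z s y).
  apply: (near_affine_derivable (fun s => z s y) x0 r1 _ e) => s sr; split; [exact: (hp s y).1|].
  exact: h1.
have hy : near_affine_on [set y | `|y - y0| <= r2] (pdy R z x0 y0) e (fun t => z x' t).
  apply: (near_affine_derivable (fun t => z x' t) y0 r2 _ e) => s sr; split; [exact: (hp x' s).2|].
  exact: h2.
have := lerD (hx x x' x1 x'1) (hy y y' y2 y'2); rewrite -mulrDr.
apply: le_trans; apply: le_trans _ (ler_normD _ _).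
by rewrite le_eqVlt; apply/orP; left; apply/eqP; congr (`|_|); ring.
Qed.

                                                                                    
                                                                                                 
                                     
(** With no errors, [dx = - p * dt], [dg = q * dt] and [dg + a * dx + b * dy = 0] give
    [dy = m * dx]. With errors, [b * (dy - m * dx)] is a combination of the three error terms. There
    [|dt|] is at most [2 * |dx| / |p|], and the part of the bound containing [|dy - m * dx|] itself
    is absorbed on the left because [e <= |b| / 2]; these two absorptions produce the factors 2 of
    the constant. *)
Lemma chart_slope (a b p q m e eta dx dy dt dg : R) : p != 0 -> b != 0 ->
  m = (q / p - a) / b -> e <= `|p| / 2 -> e <= `|b| / 2 -> 0 < e ->
  2 * (1 + `|m| + 2 * (1 + `|q / p|) / `|p|) * e <= eta * `|b| ->
  `|dx + p * dt| <= e * `|dt| -> `|dg - q * dt| <= e * `|dt| ->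
  `|dg + a * dx + b * dy| <= e * (`|dx| + `|dy|) ->
  `|dy - m * dx| <= eta * `|dx|.
Proof.
move=> p0 b0 mE ep eb e0 eK h1 h2 h3.
have P0 : 0 < `|p| by rewrite normr_gt0.
have B0 : 0 < `|b| by rewrite normr_gt0.
have dtE : `|p| * `|dt| <= `|dx| + e * `|dt|.
  have := ler_normB (dx + p * dt) dx; rewrite addrAC subrr add0r normrM => h.
  lra.
have dt2 : `|dt| <= 2 * `|dx| / `|p|.
  have h := ler_wpM2r (normr_ge0 dt) ep.
  rewrite ler_pdivlMr//; lra.
have key : b * (dy - m * dx) =
    (dg + a * dx + b * dy) - (dg - q * dt) - q / p * (dx + p * dt).
  by rewrite mE; field; rewrite p0.
have k1 : `|b| * `|dy - m * dx| <=
    e * (`|dx| + `|dy|) + e * `|dt| + `|q / p| * (e * `|dt|).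
  rewrite -normrM key; apply: le_trans (ler_normB _ _) _.
  apply: lerD; last by rewrite normrM ler_wpM2l.
  by apply: le_trans (ler_normB _ _) _; apply: lerD.
have k2 : `|dy| <= `|m| * `|dx| + `|dy - m * dx|.
  rewrite -normrM -[X in `|X| <= _](subrK (m * dx)) addrC.
  exact: ler_normD.
have e0' := ltW e0.
have k3 : (1 + `|q / p|) * `|dt| <= (1 + `|q / p|) * (2 * `|dx| / `|p|).
  by apply: ler_wpM2l => //; rewrite addr_ge0.
set D := `|dy - m * dx| in k1 k2 *.
have D0 : 0 <= D by rewrite /D.
set Q := `|q / p| in eK k1 k3 *.
set S := 2 * (1 + Q) / `|p|.
have eK' : 2 * (1 + `|m| + S) * e <= eta * `|b| by [].
have k3' : (1 + Q) * `|dt| <= S * `|dx|.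
  by apply: le_trans k3 _; rewrite /S le_eqVlt; apply/orP; left; apply/eqP; ring.
have k5 := ler_wpM2l e0' k3'.
have k4 := ler_wpM2l e0' k2.
have k6 := ler_wpM2r (normr_ge0 dx) eK'.
have k7 := ler_wpM2r D0 eb.
rewrite -(ler_pM2l B0).
lra.
Qed.

(** Precompose with the projection onto the interval, which is 1-Lipschitz, and continue with slope
    exactly [m] outside; the error constant does not grow. Working with functions on the whole line
    gives global inverses later. *)
Lemma near_affine_extend (f : R -> R) (c r m eta : R) : 0 < r -> 0 < eta ->
  near_affine_on [set x | `|x - c| <= r] m eta f ->
  exists2 h, near_affine_on setT m eta h & forall x, `|x - c| <= r -> h x = f x.
Proof.
move=> r0 eta0 hf.
pose cl x := Num.min (c + r) (Num.max (c - r) x).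
have clr x : `|cl x - c| <= r.
  rewrite ler_distl /cl; case: (leP (c - r) x) => h1.
    by case: (leP (c + r) x) => h2; apply/andP; split; lra.
  by case: (leP (c + r) (c - r)) => h2; apply/andP; split; lra.
have cl1 x x' : x <= x' -> 0 <= cl x' - cl x <= x' - x.
  move=> xx'; rewrite /cl.
  case: (leP (c + r) (Num.max _ x)); case: (leP (c + r) (Num.max _ x'));
  case: (leP (c - r) x) => h1; case: (leP (c - r) x') => h2 h3 h4;
  apply/andP; split; lra.
have cl2 x x' : `|cl x' - cl x| <= `|x' - x|.
  have [xx'|/ltW xx'] := leP x x'; have /andP[u v] := cl1 _ _ xx'.
    by rewrite !ger0_norm// (le_trans u).
  by rewrite distrC (distrC x') !ger0_norm// (le_trans u).
exists (fun x => f (cl x) + m * (x - cl x)) => [x x' _ _|x].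
  apply: le_trans _ (ler_wpM2l (ltW eta0) (cl2 x x')).
  apply: le_trans _ (hf _ _ (clr x) (clr x')).
  by rewrite le_eqVlt; apply/orP; left; apply/eqP; congr (`|_|); ring.
rewrite ler_distl => /andP[h1 h2].
suff -> : cl x = x by rewrite subrr mulr0 addr0.
by rewrite /cl max_r// min_r.
Qed.

End Chart.

(** * The solution curves as graphs over the first coordinate *)

Section LocalGraphs.
Context {R : realType}.

(** A quantitative implicit function theorem. The order of the quantifiers is what the application
    needs: [rho] is fixed before the centre [(x1, y1)], which may depend on it, and [del] is chosen
    last, from the tolerance [eps] allowed at that centre. *)
Lemma local_graphs (z : R -> R -> R) (g1 g2 : R -> R) (T0 T1 t0 x0 y0 m eta : R) :
  C2_plane R z -> T0 < t0 < T1 ->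
  (forall t, T0 < t < T1 -> derivable g1 t 1 /\ derivable g2 t 1) ->
  {for t0, continuous (derive1 g1)} -> {for t0, continuous (derive1 g2)} ->
  derive1 g1 t0 != 0 -> pdy R z x0 y0 != 0 ->
  m = (derive1 g2 t0 / derive1 g1 t0 - pdx R z x0 y0) / pdy R z x0 y0 ->
  0 < eta ->
  exists2 rho : R, 0 < rho & forall x1 y1 : R, `|x1 - x0| <= rho -> `|y1 - y0| <= rho ->
  exists w0 : R * R, forall eps : R, 0 < eps -> exists2 del : R, 0 < del &
  forall w : R * R, `|w.1 - w0.1| <= del -> `|w.2 - w0.2| <= del ->
  exists h, [/\ near_affine_on setT m eta h, `|h x1 - y1| <= eps &
    forall x, `|x - x0| <= rho ->
      exists2 t, T0 < t < T1 & w = (x + g1 t, z x (h x) + g2 t)].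
Proof.
move=> hz /andP[Tt tT] dg cg1 cg2; set p : R := derive1 g1 t0; set q : R := derive1 g2 t0.
set a := pdx R z x0 y0; set b := pdy R z x0 y0 => p0 b0 mE eta0.
have P0 : 0 < `|p| by rewrite normr_gt0.
have B0 : 0 < `|b| by rewrite normr_gt0.
pose K : R := 1 + `|m| + 2 * (1 + `|q / p|) / `|p|.
have K0 : 0 < K.
  by rewrite /K ltr_pwDl// ?ltr_pwDl// divr_ge0// mulr_ge0// addr_ge0.
(* [e] is the error of the linear approximations to [g1], [g2] and [z], small enough for
   [chart_slope] to deliver slope error [eta]. *)
have [e [e0 ep eb eK]] : exists e : R,
    [/\ 0 < e, e <= `|p| / 2, e <= `|b| / 2 & 2 * K * e <= eta * `|b|].
  exists (Num.min (`|p| / 2) (Num.min (`|b| / 2) (eta * `|b| / (2 * K)))); split.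
  - by rewrite !lt_min !divr_gt0// ?mulr_gt0.
  - by rewrite !ge_min lexx.
  - by rewrite !ge_min lexx orbT.
  - by rewrite mulrC -ler_pdivlMr ?mulr_gt0// !ge_min lexx !orbT.
pose r0 := Num.min ((t0 - T0) / 2) ((T1 - t0) / 2).
have r00 : 0 < r0 by rewrite lt_min !divr_gt0// subr_gt0.
have rT t : `|t - t0| <= r0 -> T0 < t < T1.
  rewrite le_min !ler_distl => /andP[/andP[h1 h2] /andP[h3 h4]].
  by apply/andP; split; lra.
have [ra /andP[ra0 rar0] ha] : exists2 r : R, 0 < r <= r0 &
    near_affine_on [set x | `|x - t0| <= r] p e g1.
  apply: (near_affine_C1 g1 t0 r0 e r00 e0 _ cg1) => t tr.
  exact: (dg t (rT t tr)).1.
have [rb /andP[rb0 rbr0] hb] : exists2 r : R, 0 < r <= r0 &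
    near_affine_on [set x | `|x - t0| <= r] q e g2.
  apply: (near_affine_C1 g2 t0 r0 e r00 e0 _ cg2) => t tr.
  exact: (dg t (rT t tr)).2.
have [rc rc0 hc] := C2_plane_near_affine z x0 y0 e hz e0.
rewrite -/a -/b in hc.
have [r [r1 rra rrb rrc]] : exists r : R, [/\ 0 < r, r <= ra, r <= rb & r <= rc].
  exists (Num.min ra (Num.min rb rc)); split.
  - by rewrite !lt_min ra0 rb0.
  - by rewrite ge_min lexx.
  - by rewrite !ge_min lexx orbT.
  - by rewrite !ge_min lexx !orbT.
pose Cg : R := `|q| + e; pose Cz : R := `|a| + `|b| + e.
have Cg0 : 0 < Cg by rewrite /Cg ltr_wpDl.
have Cz0 : 0 < Cz by rewrite /Cz ltr_wpDl// addr_ge0.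
(* [s] bounds [|t - t0|]; over that range [g2] varies by a small fraction of [|b| * r], so [y] can
   still be found within [r] of [y0]. *)
have [s [s0 sr sC]] : exists s : R, [/\ 0 < s, s <= r & Cg * s <= `|b| * r / 8].
  exists (Num.min r (`|b| * r / 8 / Cg)); split.
  - by rewrite lt_min r1 !divr_gt0// mulr_gt0.
  - by rewrite ge_min lexx.
  - by rewrite mulrC -ler_pdivlMr// ge_min lexx orbT.
have hg1 : near_affine_on [set x | `|x - t0| <= s] p e g1.
  by apply: near_affine_on_sub ha => x /= xs; exact: le_trans xs (le_trans sr rra).
have hg2 : near_affine_on [set x | `|x - t0| <= s] q e g2.
  by apply: near_affine_on_sub hb => x /= xs; exact: le_trans xs (le_trans sr rrb).
(* [rho] is small enough that moving [x] by [2 * rho] is compensated by some [t] within [s], and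
   that the resulting change of [z], at most [3 * Cz * rho], leaves room for [y]. *)
have [rho [rho0 rhor rhos rhoC]] : exists rho : R,
    [/\ 0 < rho, rho <= r, rho <= `|p| * s / 8 & 3 * Cz * rho <= `|b| * r / 8].
  exists (Num.min r (Num.min (`|p| * s / 8) (`|b| * r / 8 / (3 * Cz)))); split.
  - by rewrite !lt_min r1 !divr_gt0// ?mulr_gt0.
  - by rewrite ge_min lexx.
  - by rewrite !ge_min lexx orbT.
  - by rewrite mulrC -ler_pdivlMr ?mulr_gt0// !ge_min lexx !orbT.
exists rho => // x1 y1 x1r y1r.
(* For this [w0] the solution over [x1] is [t = t0], [y = y1]. Moving [w] by [del] moves [t] by at
   most [2 * del / |p|] and then [y] by at most [2 * L * del / |b|]. *)
exists (x1 + g1 t0, z x1 y1 + g2 t0) => eps eps0.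
pose L : R := 1 + Cg * (2 / `|p|).
have L0 : 0 < L by rewrite /L ltr_pwDl// mulr_ge0 ?ltW// divr_gt0.
have [del [del0 dels delr delL]] : exists del : R,
    [/\ 0 < del, del <= `|p| * s / 4, del <= `|b| * r / 8 & L * del <= eps * (`|b| / 2)].
  exists (Num.min (`|p| * s / 4) (Num.min (`|b| * r / 8) (eps * (`|b| / 2) / L))); split.
  - by rewrite !lt_min !divr_gt0// ?mulr_gt0// divr_gt0.
  - by rewrite ge_min lexx.
  - by rewrite !ge_min lexx orbT.
  - by rewrite mulrC -ler_pdivlMr// !ge_min lexx !orbT.
exists del => // -[w1 w2] /= hw1 hw2.
have Dt0 : [set x | `|x - t0| <= s] t0 by rewrite /= subrr normr0 ltW.
have rrhoc (u v : R) : `|u - v| <= rho -> `|u - v| <= rc.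
  by move=> h; exact: le_trans h (le_trans rhor rrc).
have hzy x : `|x - x0| <= rho -> near_affine_on [set y | `|y - y0| <= r] b e (z x).
  move=> xr y y' /= yr y'r.
  have := hc x x y y' (rrhoc _ _ xr) (rrhoc _ _ xr) (le_trans yr rrc) (le_trans y'r rrc).
  by rewrite subrr normr0 mulr0 subr0 add0r.
have Dy0 : [set y | `|y - y0| <= r] y0 by rewrite /= subrr normr0 ltW.
(* Two applications of [near_affine_onto]: first [t] from the first coordinate, then [y] from the
   second with this [t] fixed. *)
have ex1 x : `|x - x0| <= rho -> exists ty : R * R,
    [/\ `|ty.1 - t0| <= s, `|ty.2 - y0| <= r, x + g1 ty.1 = w1 & z x ty.2 + g2 ty.1 = w2].
  move=> xr.
  have xx1 : `|x1 - x| <= 2 * rho.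
    apply: le_trans (ler_distD x0 _ _) _; rewrite (distrC x0); clear - xr x1r; lra.
  have [//|||t ts gt] := near_affine_onto p e g1 t0 s (w1 - x) hg1.
  - exact: ltW.
  - have h1 := ler_wpM2r (ltW s0) ep.
    have -> : w1 - x - g1 t0 = (w1 - (x1 + g1 t0)) + (x1 - x) by ring.
    apply: le_trans (ler_normD _ _) _; clear - h1 xx1 hw1 rhos dels; lra.
  have gtt := near_affine_on_le _ _ _ _ _ _ hg2 Dt0 ts.
  have gtt' := ler_wpM2l (ltW Cg0) ts.
  have zz := hc x x1 y0 y1 (rrhoc _ _ xr) (rrhoc _ _ x1r)
    (le_trans Dy0 rrc) (rrhoc _ _ y1r).
  have zz' : `|z x1 y1 - z x y0| <= 3 * Cz * rho.
    have -> : z x1 y1 - z x y0 = (z x1 y1 - z x y0 - a * (x1 - x) - b * (y1 - y0))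
      + a * (x1 - x) + b * (y1 - y0) by ring.
    apply: le_trans (ler_normD _ _) _; apply: le_trans (lerD (ler_normD _ _) (lexx _)) _.
    rewrite !normrM.
    have i1 := ler_wpM2l (normr_ge0 a) xx1.
    have i2 := ler_wpM2l (normr_ge0 b) y1r.
    have i3 := ler_wpM2l (ltW e0) (lerD xx1 y1r).
    have i4 := mulr_ge0 (normr_ge0 a) (ltW rho0).
    have i5 := mulr_ge0 (normr_ge0 b) (ltW rho0).
    rewrite /Cz; clear - i1 i2 i3 i4 i5 zz; lra.
  have [//|||y yr zy] := near_affine_onto b e (z x) y0 r (w2 - g2 t) (hzy _ xr).
  - exact: ltW.
  - have h1 := ler_wpM2r (ltW r1) eb.
    have -> : w2 - g2 t - z x y0 = (w2 - (z x1 y1 + g2 t0)) - (g2 t - g2 t0)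
      + (z x1 y1 - z x y0) by ring.
    apply: le_trans (ler_normD _ _) _; apply: le_trans (lerD (ler_normB _ _) (lexx _)) _.
    have Br0 := mulr_ge0 (ltW B0) (ltW r1).
    rewrite /Cg in gtt' sC; clear - Br0 gtt gtt' sC zz' h1 hw2 rhoC delr; lra.
  by exists (t, y); split => //=; [rewrite gt|rewrite zy]; ring.
have /choice[ty tyP] (x : R) : exists ty : R * R, `|x - x0| <= rho ->
    [/\ `|ty.1 - t0| <= s, `|ty.2 - y0| <= r, x + g1 ty.1 = w1 & z x ty.2 + g2 ty.1 = w2].
  have [/ex1[c cP]|n] := pselect (`|x - x0| <= rho); first by exists c.
  by exists (0, 0) => /n.
have hy : near_affine_on [set x | `|x - x0| <= rho] m eta (fun x => (ty x).2).
  move=> x x' /= xr x'r.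
  have [ts yr E1 E2] := tyP x xr; have [ts' yr' E1' E2'] := tyP x' x'r.
  apply: (chart_slope a b p q m e eta _ _ ((ty x').1 - (ty x).1)
    (g2 (ty x').1 - g2 (ty x).1)) => //.
  - have := hg1 _ _ ts ts'; rewrite -normrN.
    have -> // : - (g1 (ty x').1 - g1 (ty x).1 - p * ((ty x').1 - (ty x).1)) =
      x' - x + p * ((ty x').1 - (ty x).1).
    have F : x' - x = g1 (ty x).1 - g1 (ty x').1.
      by clear - E1 E1'; lra.
    by rewrite F; ring.
  - exact: hg2.
  - have := hc _ _ _ _ (rrhoc _ _ xr) (rrhoc _ _ x'r) (le_trans yr rrc) (le_trans yr' rrc).
    rewrite -normrN; congr (`|_| <= _).
    have -> : z x' (ty x').2 = w2 - g2 (ty x').1 by rewrite -E2' addrK.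
    have -> : z x (ty x).2 = w2 - g2 (ty x).1 by rewrite -E2 addrK.
    ring.
have [h hh hE] := near_affine_extend _ _ _ _ _ rho0 eta0 hy.
exists h; split => //.
  rewrite hE//; have [ts yr E1 E2] := tyP x1 x1r.
  have tt := near_affine_on_ge _ _ _ _ _ _ hg1 Dt0 ts.
  have tt2 : g1 (ty x1).1 - g1 t0 = w1 - (x1 + g1 t0) by clear - E1; lra.
  rewrite tt2 in tt.
  have tt3 := ler_wpM2r (normr_ge0 ((ty x1).1 - t0)) ep.
  have tt4 : `|(ty x1).1 - t0| <= del * (2 / `|p|).
    by rewrite mulrA ler_pdivlMr//; clear - tt tt3 hw1; lra.
  have gg := near_affine_on_le _ _ _ _ _ _ hg2 Dt0 ts.
  have y1rr : [set y | `|y - y0| <= r] y1 by exact: le_trans y1r rhor.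
  have zz := near_affine_on_ge _ _ _ _ _ _ (hzy _ x1r) y1rr yr.
  have zz2 : z x1 (ty x1).2 - z x1 y1 =
    (w2 - (z x1 y1 + g2 t0)) - (g2 (ty x1).1 - g2 t0) by clear - E2; lra.
  rewrite zz2 in zz.
  have zz3 := le_trans zz (ler_normB _ _).
  have zz4 := ler_wpM2r (normr_ge0 ((ty x1).2 - y1)) eb.
  have gg2 := ler_wpM2l (ltW Cg0) tt4.
  rewrite -(@ler_pM2r _ (`|b| / 2)) ?divr_gt0//.
  rewrite /L in delL; rewrite -/Cg in gg; clear - delL gg gg2 zz3 zz4 hw2; lra.
move=> x xr; have [ts yr E1 E2] := tyP x xr.
exists (ty x).1; first by apply: rT; exact: le_trans ts (le_trans sr (le_trans rra rar0)).
by rewrite hE// E1 E2.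
Qed.

End LocalGraphs.

                                                                                                
                                                                                               
(** [eta] may depend only on [m], since [local_graphs] needs it to produce [rho]. The centre
    [(x1, y1)] is allowed to differ from [(x0, y0)] and to vary with [rho]: for Cantor sets it sits
    next to gaps whose size depends on the scale. *)
Definition graph_stable {R : realType} (A B : set R) (x0 y0 : R) :=
  forall m : R, m != 0 -> exists2 eta : R, 0 < eta &
  forall rho : R, 0 < rho -> exists x1 y1 e : R,
  [/\ `|x1 - x0| <= rho, `|y1 - y0| <= rho, 0 < e &
  forall h, near_affine_on setT m eta h -> `|h x1 - y1| <= e ->
  exists x, [/\ `|x - x0| <= rho, A x & B (h x)]].

(** * From stable intersections to interior points of the sum *)

Section GraphStable.
Context {R : realType}.

Lemma near_affine_comb (D : set R) m1 m2 e (f1 f2 : R -> R) (al be : R) :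
  near_affine_on D m1 e f1 -> near_affine_on D m2 e f2 ->
  near_affine_on D (al * m1 + be * m2) ((`|al| + `|be|) * e)
    (fun x => al * f1 x + be * f2 x).
Proof.
move=> h1 h2 x x' Dx Dx'.
have k1 := ler_wpM2l (normr_ge0 al) (h1 x x' Dx Dx').
have k2 := ler_wpM2l (normr_ge0 be) (h2 x x' Dx Dx').
have := lerD k1 k2; rewrite -!normrM !mulrA -!mulrDl.
apply: le_trans; apply: le_trans _ (ler_normD _ _).
by rewrite le_eqVlt; apply/orP; left; apply/eqP; congr (`|_|); ring.
Qed.

(** Used with the components of the velocity in place of [g1] and [g2], so the Wronskian is the
    curvature determinant. If the linear form vanishes at [c], its derivative [M] there does not,
    because [(al, be)] cannot annihilate two independent vectors; a second zero close by would
    contradict the slope [M]. If it does not vanish at [c], continuity suffices. *)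
Lemma curvature_isolated_zero (g1 g2 : R -> R) (c r0 al be : R) : 0 < r0 ->
  (forall t, `|t - c| <= r0 -> derivable g1 t 1 /\ derivable g2 t 1) ->
  {for c, continuous (derive1 g1)} -> {for c, continuous (derive1 g2)} ->
  g1 c * derive1 g2 c - g2 c * derive1 g1 c != 0 -> (al, be) <> (0, 0) ->
  exists2 r : R, 0 < r & forall s, 0 < `|s - c| -> `|s - c| <= r ->
    al * g1 s + be * g2 s != 0.
Proof.
move=> r00 dg c1 c2 W ab.
set u1 : R := derive1 g1 c; set u2 : R := derive1 g2 c.
set M : R := al * u1 + be * u2.
have na (e : R) : 0 < e -> exists2 r : R, 0 < r &
    near_affine_on [set x | `|x - c| <= r] M ((`|al| + `|be|) * e)
    (fun x => al * g1 x + be * g2 x).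
  move=> e0.
  have [ra /andP[ra0 _] ha] := near_affine_C1 g1 c r0 e r00 e0 (fun t tr => (dg t tr).1) c1.
  have [rb /andP[rb0 _] hb] := near_affine_C1 g2 c r0 e r00 e0 (fun t tr => (dg t tr).2) c2.
  exists (Num.min ra rb); first by rewrite lt_min ra0.
  apply: near_affine_comb.
    by apply: near_affine_on_sub ha => x /=; rewrite le_min => /andP[].
  by apply: near_affine_on_sub hb => x /=; rewrite le_min => /andP[].
have [L0|L0] := eqVneq (al * g1 c + be * g2 c) 0.
  have M0 : M != 0.
    apply/eqP => M0; apply: ab.
    have e1 : al * (g1 c * u2 - g2 c * u1) = 0.
      rewrite (_ : _ * _ = u2 * (al * g1 c + be * g2 c) - g2 c * M).
        by rewrite L0 M0 !mulr0 subr0.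
      by rewrite /M; ring.
    have e2 : be * (g1 c * u2 - g2 c * u1) = 0.
      rewrite (_ : _ * _ = g1 c * M - u1 * (al * g1 c + be * g2 c)).
        by rewrite L0 M0 !mulr0 subr0.
      by rewrite /M; ring.
    move/eqP: e1; rewrite mulf_eq0 (negbTE W) orbF => /eqP ->.
    by move/eqP: e2; rewrite mulf_eq0 (negbTE W) orbF => /eqP ->.
  have S0 : 0 < `|al| + `|be| + 1 by rewrite ltr_wpDl// addr_ge0.
  have M0' : 0 < `|M| by rewrite normr_gt0.
  have [|r r1 hr] := na (`|M| / 2 / (`|al| + `|be| + 1)).
    by rewrite !divr_gt0.
  exists r => // s s0 sr; apply/eqP => Ls.
  have Dc : [set x | `|x - c| <= r] c by rewrite /= subrr normr0 ltW.
  have := near_affine_on_ge _ _ _ _ _ _ hr Dc sr.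
  rewrite L0 Ls subrr normr0 pmulr_lle0// subr_le0.
  apply/negP; rewrite -ltNge mulrA ltr_pdivrMr//.
  have := addr_ge0 (normr_ge0 al) (normr_ge0 be) => h.
  have k := mulr_ge0 h (ltW M0').
  by clear - M0' k; lra.
have [r r1 hr] := na 1 ltr01; rewrite mulr1 in hr.
set E := `|al| + `|be| in hr.
have Lc : 0 < `|al * g1 c + be * g2 c| by rewrite normr_gt0.
have E0 : 0 < `|M| + E + 1 by rewrite ltr_wpDl// !addr_ge0.
exists (Num.min r (`|al * g1 c + be * g2 c| / (`|M| + E + 1) / 2)).
  by rewrite lt_min r1 !divr_gt0.
move=> s s0; rewrite le_min => /andP[sr sE]; apply/eqP => Ls.
have Dc : [set x | `|x - c| <= r] c by rewrite /= subrr normr0 ltW.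
have := near_affine_on_le _ _ _ _ _ _ hr Dc sr.
rewrite Ls sub0r normrN => h.
move: sE; rewrite ler_pdivlMr// ler_pdivlMr// => sE.
have k : 0 <= (`|M| + E) * `|s - c| by rewrite mulr_ge0// !addr_ge0.
by clear - h sE k s0 Lc; lra.
Qed.

Lemma graph_stable_interior (z : R -> R -> R) (A B : set R) (G : set (R * R)) x0 y0 :
  C2_plane R z -> pdy R z x0 y0 != 0 -> contains_C2_curve_nonvanishing_curvature R G ->
  graph_stable A B x0 y0 ->
  interior (plane_sum R (Pset R z A B) G) !=set0.
Proof.
move=> hz b0 [T0 [T1 [g1 [g2 [T01 hG]]]]] hAB.
set a := pdx R z x0 y0.
pose c := (T0 + T1) / 2; pose r0 := (T1 - T0) / 4.
have r00 : 0 < r0 by rewrite divr_gt0// subr_gt0.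
have rT t : `|t - c| <= r0 -> T0 < t /\ t < T1.
  by rewrite ler_distl /c /r0 => /andP[h1 h2]; clear - h1 h2 T01; split; lra.
have iso al be : (al, be) <> (0, 0) -> exists2 r : R, 0 < r &
    forall s, 0 < `|s - c| -> `|s - c| <= r ->
    al * derive1 g1 s + be * derive1 g2 s != 0.
  move=> ab.
  have cc : `|c - c| <= r0 by rewrite subrr normr0 ltW.
  have [Tc cT] := rT c cc.
  have [_ [_ [_ [_ [c1 [c2 [_ [W _]]]]]]]] := hG c Tc cT.
  apply: (curvature_isolated_zero (derive1 g1) (derive1 g2) c r0 al be r00 _ c1 c2 W ab).
  move=> t /rT[Tt tT]; have [_ [_ [d1 [d2 _]]]] := hG t Tt tT.
  exact: conj d1 d2.
(* The form [(1, 0)] yields [g1' != 0], and the form [(- a, 1)] yields [g2' - a * g1' != 0], that is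
   [m != 0]. Both hold at the common parameter [t0 = c + d]. *)
have [|ra ra0 ha] := iso 1 0; first by case=> /eqP; rewrite oner_eq0.
have [|rb rb0 hb] := iso (- a) 1; first by case=> _ /eqP; rewrite oner_eq0.
pose d := Num.min r0 (Num.min ra rb).
have d0 : 0 < d by rewrite !lt_min r00 ra0.
pose t0 := c + d.
have tE : `|t0 - c| = d by rewrite /t0 addrC addKr gtr0_norm.
have tc0 : 0 < `|t0 - c| by rewrite tE.
have tra : `|t0 - c| <= ra by rewrite tE /d !ge_min lexx orbT.
have trb : `|t0 - c| <= rb by rewrite tE /d !ge_min lexx !orbT.
have [Tt tT] : T0 < t0 /\ t0 < T1 by apply: rT; rewrite tE ge_min lexx.
have p0 : derive1 g1 t0 != 0.
  by have := ha t0 tc0 tra; rewrite mul1r mul0r addr0.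
have q0 : derive1 g2 t0 - a * derive1 g1 t0 != 0.
  by have := hb t0 tc0 trb; rewrite mul1r mulNr addrC.
pose m := (derive1 g2 t0 / derive1 g1 t0 - a) / pdy R z x0 y0.
have m0 : m != 0.
  rewrite mulf_neq0 ?invr_eq0//.
  have -> : derive1 g2 t0 / derive1 g1 t0 - a
    = (derive1 g2 t0 - a * derive1 g1 t0) / derive1 g1 t0.
    by rewrite mulrBl mulfK.
  by rewrite mulf_neq0 ?invr_eq0.
have [eta eta0 heta] := hAB m m0.
have cont (g : R -> R) t : derivable g t 1 -> {for t, continuous g}.
  by move/derivable1_diffP; exact: differentiable_continuous.
have [_ [_ [/cont c1 [/cont c2 _]]]] := hG t0 Tt tT.
have [||rho rho0 hrho] := local_graphs z g1 g2 T0 T1 t0 x0 y0 m eta hz _ _ c1 c2 p0 b0 erefl eta0.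
- by rewrite Tt.
- move=> t /andP[u v]; have [d1 [d2 _]] := hG t u v.
  exact: conj d1 d2.
have [x1 [y1 [e [x1r y1r e0 he]]]] := heta rho rho0.
have [w0 hw0] := hrho x1 y1 x1r y1r.
have [del del0 hdel] := hw0 e e0.
exists w0; apply/nbhs_ballP; exists del => //= w [w1 w2].
have [||h [hh h1 hx]] := hdel w.
- by rewrite distrC; exact: ltW.
- by rewrite distrC; exact: ltW.
have [x [xr Ax Bx]] := he h hh h1.
have [t /andP[ut tv] wE] := hx x xr.
have [_ [_ [_ [_ [_ [_ [_ [_ Gt]]]]]]]] := hG t ut tv.
exists (x, z x (h x)), (g1 t, g2 t); split; first by exists x, (h x).
by split.
Qed.

End GraphStable.

(** * Sets of second category and co-countable sets *)

Section SigmaIdeals.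
Context {R : realType}.

(** Lindelöf argument: otherwise each point of [S] has a rational interval around it on which [S]
    belongs to the ideal, and countably many such pieces cover [S]. It serves both meagre sets and
    countable sets. *)
Lemma sigma_ideal_local (P : set R -> Prop) :
  (forall S S' : set R, S `<=` S' -> P S' -> P S) ->
  (forall F : nat -> set R, (forall n, P (F n)) -> P (\bigcup_n F n)) -> P set0 ->
  forall S : set R, ~ P S ->
  exists2 y, S y & forall r, 0 < r -> ~ P (S `&` [set x | `|x - y| <= r]).
Proof.
move=> Psub Pbig P0 S nPS; apply: contrapT => hn; apply: nPS.
have hS y : S y -> exists2 r : R, 0 < r & P (S `&` [set x | `|x - y| <= r]).
  move=> Sy; apply: contrapT => h; apply: hn; exists y => // r r0 Pr.
  by apply: h; exists r.
pose J (q : rat * rat) : set R := S `&` [set x | ratr q.1 < x < ratr q.2].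
(* Indices that code no interval, or one whose piece is not in the ideal, get the empty set. *)
pose F n : set R := if unpickle n is Some q then
  if `[< P (J q) >] then J q else set0 else set0.
apply: (Psub _ (\bigcup_n F n)).
  move=> y Sy; have [r r0 Pr] := hS y Sy.
  have yr : y - r < y by rewrite gtrBl.
  have ry : y < y + r by rewrite ltrDl.
  have [q1] := rat_in_itvoo yr; rewrite in_itv/= => /andP[q11 q12].
  have [q2] := rat_in_itvoo ry; rewrite in_itv/= => /andP[q21 q22].
  exists (pickle (q1, q2)); [exact: I|]; rewrite /F pickleK.
  have PJ : P (J (q1, q2)).
    apply: Psub Pr => x [Sx /= /andP[h1 h2]]; split => //=.
    by rewrite ler_distl !ltW// (lt_trans _ h1, lt_trans h2).
  by rewrite (asboolT PJ); split => //=; rewrite q12 q21.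
apply: Pbig => n; rewrite /F; case: unpickle => [q|//].
by case: asboolP.
Qed.

Lemma nowhere_denseS (S S' : set R) : S `<=` S' -> nowhere_dense R S' -> nowhere_dense R S.
Proof.
move=> SS' nS'; apply/seteqP; split => // x.
by rewrite -nS'; apply: interiorS; exact: closureS.
Qed.

Lemma nowhere_dense0 : nowhere_dense R set0.
Proof. by rewrite /nowhere_dense closure0 interior0. Qed.

Lemma first_category0 : first_category R set0.
Proof.
exists (fun=> set0); split; first by move=> _; exact: nowhere_dense0.
by rewrite bigcup0.
Qed.

Lemma first_categoryS (S S' : set R) : S `<=` S' -> first_category R S' ->
  first_category R S.
Proof.
move=> SS' [F [nF S'E]]; exists (fun n => S `&` F n); split.
  by move=> n; apply: nowhere_denseS (nF n); exact: subIsetr.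
by rewrite -setI_bigcupr -S'E setIidl.
Qed.

Lemma first_category_bigcup (F : nat -> set R) : (forall n, first_category R (F n)) ->
  first_category R (\bigcup_n F n).
Proof.
move=> /choice[G hG].
exists (fun n => if unpickle n is Some (i, j) then G i j else set0); split.
  move=> n; case: unpickle => [[i j]|]; first by have [] := hG i.
  exact: nowhere_dense0.
apply/seteqP; split => [x [i _]|x [n _]].
  have [_ ->] := hG i => -[j _ Gx].
  exists (pickle (i, j)); [exact: I|]; rewrite pickleK.
  exact: Gx.
case: unpickle => [[i j] Gx|//].
by exists i => //; have [_ ->] := hG i; exists j.
Qed.

(** By [near_affine_onto], [h] maps a ball onto a set containing a ball, so a ball in the closure of
    the preimage would force one in the closure of [N]. *)
Lemma near_affine_preimage_nowhere_dense (m eta : R) h (N : set R) :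
  near_affine_on setT m eta h -> 0 < eta -> eta < `|m| ->
  nowhere_dense R N -> nowhere_dense R (h @^-1` N).
Proof.
move=> hh eta0 etam nN; apply/seteqP; split => // x /nbhs_ballP[r /= r0 hr].
suff : interior (closure N) (h x) by rewrite nN.
have k0 : 0 < `|m| - eta by rewrite subr_gt0.
have cl : closed (h @^-1` closure N).
  have /continuous_closedP := near_affine_continuous _ _ _ hh eta0.
  by apply; exact: closed_closure.
have sub : closure (h @^-1` N) `<=` h @^-1` closure N.
  rewrite closureE; apply: smallest_sub => // y Ny; exact: (@subset_closure _ N (h y) Ny).
apply/nbhs_ballP; exists ((`|m| - eta) * (r / 2)); first by rewrite /= mulr_gt0// divr_gt0.
move=> y; rewrite /ball/= => /ltW; rewrite distrC => yr.
have [|//||u ux <-] := near_affine_onto m eta h x (r / 2) y _ _ _ yr.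
- by move=> ? ? _ _; exact: hh.
- by rewrite divr_ge0// ltW.
apply: sub; apply: hr; rewrite /ball/= distrC.
by apply: le_lt_trans ux _; rewrite ltr_pdivrMr// ltr_pMr// ltr1n.
Qed.

Lemma near_affine_preimage_first_category (m eta : R) h (S : set R) :
  near_affine_on setT m eta h -> 0 < eta -> eta < `|m| ->
  first_category R S -> first_category R (h @^-1` S).
Proof.
move=> hh eta0 etam [F [nF ->]]; exists (fun n => h @^-1` F n); split.
  by move=> n; exact: near_affine_preimage_nowhere_dense _ _ _ _ hh eta0 etam (nF n).
exact: preimage_bigcup.
Qed.

Lemma second_category_graph_stable (A B : set R) :
  second_category R A -> second_category R B -> baire_set R B ->
  exists x0 y0, (x0, y0) <> (0, 0) /\ graph_stable A B x0 y0.
Proof.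
move=> sA sB [E [M [oE [fM BE]]]].
have [x0 Ax0 hx0] := sigma_ideal_local _ first_categoryS first_category_bigcup
  first_category0 A sA.
have [y1 Ey1] : E !=set0.
  apply/set0P/eqP => E0; apply: sB; apply: first_categoryS fM.
  by rewrite BE E0 set0D set0U setD0.
have [y0 y00 Ey0] : exists2 y0, y0 != 0 & E y0.
  have [y10|] := eqVneq y1 0; last by exists y1.
  have /nbhs_ballP[r /= r0 hr] : nbhs y1 E by apply: open_nbhs_nbhs; split.
  exists (r / 2); first by rewrite gt_eqF// divr_gt0.
  apply: hr; rewrite /ball/= y10 sub0r normrN gtr0_norm ?divr_gt0//.
  by rewrite ltr_pdivrMr// ltr_pMr// ltr1n.
have /nbhs_ballP[r /= r0 hr] : nbhs y0 E by apply: open_nbhs_nbhs; split.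
exists x0, y0; split; first by case=> _ /eqP; rewrite (negbTE y00).
move=> m m0; have m0' : 0 < `|m| by rewrite normr_gt0.
have eta0 : 0 < `|m| / 2 by rewrite divr_gt0.
exists (`|m| / 2) => // rho rho0.
exists x0, y0, (r / 4); split; rewrite ?subrr ?normr0 ?divr_gt0 ?ltW// => h hh hy.
(* On [|x - x0| <= s] the values of [h] stay within [r / 4 + 3 * |m| * s / 2 < r] of [y0], hence in
   the open set [E]; only the meagre set [M] must then be avoided. *)
have [s [s0 srho sr]] : exists s : R, [/\ 0 < s, s <= rho & 2 * `|m| * s <= r / 2].
  exists (Num.min rho (r / 2 / (2 * `|m|))); split.
  - by rewrite lt_min rho0 !divr_gt0// mulr_gt0.
  - by rewrite ge_min lexx.
  - by rewrite mulrC -ler_pdivlMr ?mulr_gt0// ge_min lexx orbT.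
have [x [[Ax /= xs] nMx]] : exists x, (A `&` [set x | `|x - x0| <= s]) x /\ ~ M (h x).
  apply: contrapT => hn; apply: (hx0 s s0).
  have etam : `|m| / 2 < `|m| by rewrite ltr_pdivrMr// ltr_pMr// ltr1n.
  apply: first_categoryS (near_affine_preimage_first_category _ _ _ _ hh eta0 etam fM).
  by move=> x Ax; apply: contrapT => nM; apply: hn; exists x.
exists x; split => //; first exact: le_trans xs srho.
rewrite BE; left; split => //; apply: hr.
rewrite /ball/= distrC; apply: le_lt_trans (ler_distD (h x0) _ _) _.
have h1 := near_affine_on_le _ _ _ _ x0 x hh I I.
have h2 := ler_wpM2l (ltW m0') xs.
by clear - h1 h2 hy sr r0; lra.
Qed.

Lemma uncountable_real : ~ countable [set: R].
Proof.
move=> /countable_lebesgue_measure0.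
have := @lebesgue_measure_itv R `[0, 1]; rewrite /= lte_fin ltr01 sube0 => e h.
have : ((1%:E : \bar R) <= 0)%E.
  by rewrite -h -e le_outer_measure//.
by rewrite lee_fin ler10.
Qed.

Lemma cocountable_graph_stable (A B : set R) :
  (exists J1 : set R, nondegenerate_interval R J1 /\ (J1 `\` A) #= [set: nat]) ->
  B #= [set: R] ->
  exists x0 y0, (x0, y0) <> (0, 0) /\ graph_stable A B x0 y0.
Proof.
move=> [J [[itvJ [xa [xb [Ja [Jb xab]]]]] cJ]] cB.
have cJA : countable (J `\` A) by rewrite (eq_countable cJ).
have nB : ~ countable (B `\ 0).
  move=> c0; apply: uncountable_real; rewrite -(eq_countable cB).
  apply: (@sub_countable _ _ _ ((B `\ 0) `|` [set 0])).
    by apply: subset_card_le => x Bx; have [->|/eqP x0] := eqVneq x 0; [right|left].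
  rewrite -bigcup2E; apply: bigcup_countable => [//|[|[|n]] _ /=].
  - exact: c0.
  - exact: countable1.
  - exact: countable0.
have [|F cF||y0 [By0 y00] hy0] := @sigma_ideal_local (@countable R) _ _ _ _ nB.
- by move=> S S' SS'; apply: sub_countable; exact: subset_card_le.
- exact: bigcup_countable.
- exact: countable0.
pose x0 := (xa + xb) / 2; pose d := (xb - xa) / 2.
have d0 : 0 < d by rewrite divr_gt0// subr_gt0.
have Jd x : `|x - x0| <= d -> J x.
  rewrite ler_distl /x0 /d => /andP[h1 h2].
  by apply: (itvJ xa x xb) => //; clear - h1 h2; lra.
exists x0, y0; split; first by case=> _.
move=> m m0; have m0' : 0 < `|m| by rewrite normr_gt0.
have eta0 : 0 < `|m| / 2 by rewrite divr_gt0.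
exists (`|m| / 2) => // rho rho0.
pose s := Num.min rho d.
have s0 : 0 < s by rewrite lt_min rho0.
exists x0, y0, (`|m| * s / 4).
split; rewrite ?subrr ?normr0 ?divr_gt0 ?mulr_gt0 ?ltW// => h hh hy.
apply: contrapT => hn.
apply: (hy0 (`|m| * s / 4)); first by rewrite divr_gt0// mulr_gt0.
(* Every point of [B] near [y0] is a value [h u] with [u] in [J]. If no such [u] is in [A], then [B]
   is locally contained in a countable image. *)
apply: (@sub_countable _ _ _ (h @` (J `\` A))).
  apply: subset_card_le => y [[By _] /= yr].
  have [||||u us uy] := near_affine_onto m (`|m| / 2) h x0 s y.
  - by move=> ? ? _ _; exact: hh.
  - exact: eta0.
  - exact: ltW.
  - apply: le_trans (ler_distD y0 _ _) _; rewrite (distrC y0).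
    by clear - hy yr; lra.
  move: us; rewrite le_min => /andP[u1 u2].
  exists u => //; split; first exact: Jd.
  by move=> Au; apply: hn; exists u; rewrite uy.
exact: sub_countable (card_image_le _ _) cJA.
Qed.

End SigmaIdeals.

(** * Sets of positive measure *)

Section OuterMeasure.
Context {R : realType}.
Local Notation lam := ((@wlength R idfun)^*)%mu.

Lemma outer_measure_closed_ball (c r : R) : 0 <= r -> lam [set x | `|x - c| <= r] = (2 * r)%:E.
Proof.
move=> r0; have -> : [set x | `|x - c| <= r] = `[c - r, c + r]%classic.
  by apply/seteqP; split => x /=; rewrite in_itv/= ler_distl.
have := @lebesgue_measure_itv R `[c - r, c + r]; rewrite /= lte_fin => e.
transitivity (lebesgue_measure (`[c - r, c + r]%classic : set R)) => //.
rewrite e; case: ltP => h; last by congr (_%:E); clear - h r0; lra.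
by rewrite -EFinB; congr (_%:E); ring.
Qed.

(** Cover [S] by open intervals. The image of each lies in the closed ball about the image of its
    midpoint, of radius [L] times half its length, so the constant is exactly [L]. *)
Lemma outer_measure_lipschitz_image (g : R -> R) (L : R) (S : set R) : 0 < L ->
  (forall y y', `|g y' - g y| <= L * `|y' - y|) -> (lam (g @` S) <= L%:E * lam S)%E.
Proof.
move=> L0 hg; rewrite -lee_pdivrMl// [leRHS]measurable_realfun.outer_measure_open_itv_cover.
apply: le_ereal_inf_tmp => _ [F [Fitv SF] <-].
rewrite lee_pdivrMl// -nneseriesZl; last by move=> i _; exact: wlength_ge0.
apply: (@le_trans _ _ (lam (\bigcup_k (g @` F k)))).
  rewrite -image_bigcup; apply: le_outer_measure; exact: image_subset.
apply: le_trans (outer_measure_sigma_subadditive _ _) _.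
apply: lee_nneseries => [i _ _|k _]; first exact: outer_measure_ge0.
have [[a b] /= ->] := Fitv k; rewrite wlength_itv /= lte_fin.
case: ltP => [ab|ba]; last first.
  by rewrite set_itv_ge ?bnd_simp -?leNgt// image_set0 outer_measure0 mule0.
rewrite -EFinB -EFinM.
have -> : L * (b - a) = 2 * (L * ((b - a) / 2)) by field.
rewrite -(outer_measure_closed_ball (g ((a + b) / 2))); last first.
  by rewrite mulr_ge0 ?ltW// divr_gt0// subr_gt0.
apply: le_outer_measure => _ [x /= xab <-] /=.
apply: le_trans (hg _ _) _; rewrite ler_pM2l// ler_distl.
by move: xab; rewrite in_itv/= => /andP[h1 h2]; apply/andP; split; clear - h1 h2; lra.
Qed.

Lemma outer_measure_split (E X : set R) : measurable (E : set (measurableTypeR R)) ->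
  lam X = (lam (X `&` E) + lam (X `&` ~` E))%E.
Proof. by move=> mE; exact: (@sub_caratheodory _ _ _ (@wlength R idfun) E mE X). Qed.

                                                                                               
                                    
(** Stated for outer measure so as to cover sets that are not Borel. Apply the density theorem to a
    G-delta hull [G] of [S] with the same measure. Splitting both sets along a ball and cancelling
    the finite part outside it shows that [S] fills the ball as much as [G] does. *)
Lemma outer_density (S : set R) (eps : R) : (lam S < +oo)%E -> (0 < lam S)%E -> 0 < eps ->
  exists2 x, S x & exists2 d : R, 0 < d & forall r, 0 < r -> r < d ->
    (((1 - eps) * (2 * r))%:E <= lam (S `&` [set y | (`|y - x| <= r)%R]))%E.
Proof.
move=> Soo S0 eps0.
have [F [oF SG GS]] := outer_measure_Gdelta S.
set G := \bigcap_i F i in SG GS.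
have mG : measurable (G : set (measurableTypeR R)).
  by apply: bigcapT_measurable => i; exact: measurable_realfun.open_measurable.
have [N [mN N0 hN]] := lebesgue_density mG.
have [x Sx Nx] : exists2 x, S x & ~ N x.
  apply: contrapT => h; move: S0; rewrite ltNge => /negP; apply.
  rewrite -[leRHS]N0; apply: le_outer_measure => x Sx.
  by apply: contrapT => Nx; apply: h; exists x.
exists x => //.
have cvgx : (lebesgue_measure (G `&` ball x r) / lebesgue_measure (ball x r))%E
    @[r --> 0^'+] --> (1%:E : \bar R).
  apply: contrapT => h; apply: Nx; apply: hN => /= h'; apply: h.
  by move: h'; rewrite indicE mem_set//; exact: SG.
have : \forall r \near (0 : R)^'+, ((1 - eps)%:E <
    lebesgue_measure (G `&` ball x r) / lebesgue_measure (ball x r))%E.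
  apply: (cvgx [set y | ((1 - eps)%:E < y)%E]).
  by apply: open_nbhs_nbhs; split; [exact: open_ereal_gt_ereal|rewrite /= lte_fin gtrBl].
rewrite near_withinE => /nbhs_ballP[d /= d0 hd].
exists d => // r r0 rd.
have /hd /(_ r0) : ball (0 : R) d r by rewrite /ball/= sub0r normrN gtr0_norm.
have r20 : 0 < r *+ 2 by rewrite mulrn_wgt0.
rewrite (lebesgue_measure_ball x (ltW r0)) inver gt_eqF// => /ltW.
rewrite lee_pdivlMr// -EFinM -[r *+ 2]mulr_natl => h.
apply: le_trans h _.
have mB : measurable (ball x r : set (measurableTypeR R)).
  by apply: measurable_realfun.open_measurable; exact: ball_open.
have e1 := outer_measure_split (ball x r) S mB.
have e2 := outer_measure_split (ball x r) G mB.
have fin X : X `<=` G -> lam X \is a fin_num.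
  move=> XG; rewrite ge0_fin_numE ?outer_measure_ge0//.
  by apply: le_lt_trans Soo; rewrite -GS; exact: le_outer_measure.
have GS' : lam G = lam S by exact: GS.
apply: (@le_trans _ _ (lam (S `&` ball x r))); last first.
  by apply: le_outer_measure => y [Sy /ltW yr]; split => //=; rewrite distrC.
have f1 : lam (S `&` ~` ball x r) \is a fin_num by apply: fin => y [/SG].
have : (lam (G `&` ball x r) + lam (S `&` ~` ball x r) <=
    lam (S `&` ball x r) + lam (S `&` ~` ball x r))%E.
  rewrite -e1 -GS' e2; apply: leeD2l; apply: le_outer_measure.
  by move=> y [Sy nb]; split => //; exact: SG.
by rewrite leeD2rE.
Qed.

Lemma bounded_outer_measure_lty (S : set R) : Rbounded R S -> (lam S < +oo)%E.
Proof.
move=> [M hM]; apply: (@le_lt_trans _ _ (lam [set x | `|x - 0| <= `|M|])).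
  by apply: le_outer_measure => x Sx /=; rewrite subr0; apply: le_trans (hM _ Sx) (ler_norm _).
by rewrite outer_measure_closed_ball// ltry.
Qed.

Lemma outer_measure_setD1 (S : set R) (c : R) : lam (S `\ c) = lam S.
Proof.
apply/eqP; rewrite eq_le; apply/andP; split.
  by apply: le_outer_measure => x [].
have c0 : lam [set c] = 0%E by exact: (lebesgue_measure_set1 c).
rewrite -[leRHS]adde0 -c0; apply: le_trans _ (outer_measureU2 _ _ _).
apply: le_outer_measure => x Sx.
by have [->|/eqP xc] := eqVneq x c; [right|left].
Qed.

Lemma positive_measure_graph_stable (A B : set R) : Rbounded R A -> Rbounded R B ->
  positive_lebesgue_measure R A -> positive_lebesgue_measure R B ->
  exists x0 y0, (x0, y0) <> (0, 0) /\ graph_stable A B x0 y0.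
Proof.
move=> bA bB [mA A0] [mB B0].
have e0 : 0 < (1 / 10 : R) by rewrite divr_gt0.
have [x0 Ax0 [dA dA0 hA]] := outer_density A (1 / 10) (bounded_outer_measure_lty A bA) A0 e0.
have [||y0 [By0 y00] [dB dB0 hB]] := outer_density (B `\ 0) (1 / 10) _ _ e0.
- by rewrite outer_measure_setD1; exact: bounded_outer_measure_lty.
- by rewrite outer_measure_setD1.
exists x0, y0; split; first by case=> _.
move=> m m0; have m0' : 0 < `|m| by rewrite normr_gt0.
have eta0 : 0 < `|m| / 10 by rewrite divr_gt0.
have etam : `|m| / 10 < `|m| by clear - m0'; lra.
exists (`|m| / 10) => // rho rho0.
have [r [r0 rrho rA rB]] : exists r : R, [/\ 0 < r, r <= rho, r < dA & 2 * `|m| * r < dB].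
  exists (Num.min rho (Num.min (dA / 2) (dB / (4 * `|m|)))); split.
  - by rewrite !lt_min rho0 !divr_gt0// mulr_gt0.
  - by rewrite ge_min lexx.
  - rewrite !gt_min; apply/orP; right; apply/orP; left.
    by rewrite ltr_pdivrMr// ltr_pMr// ltr1n.
  - have k : Num.min rho (Num.min (dA / 2) (dB / (4 * `|m|))) <= dB / (4 * `|m|).
      by rewrite !ge_min lexx !orbT.
    move: k; set q := Num.min rho _; rewrite ler_pdivlMr ?mulr_gt0// => k.
    by clear - k dB0; lra.
have mr := mulr_gt0 m0' r0.
(* [h] sends [I1] into [I2]: its values differ from [h x0] by at most [11 / 10 * |m| * r], and
   [h x0] is within [s / 4 = |m| * r / 2] of [y0]. *)
pose s := 2 * `|m| * r.
have s0 : 0 < s by rewrite !mulr_gt0.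
exists x0, y0, (s / 4); split; rewrite ?subrr ?normr0 ?divr_gt0 ?ltW// => h hh hy.
apply: contrapT => hn.
have [g [gh hg gL]] := near_affine_inverse _ _ _ hh eta0 etam.
have k0 : 0 < `|m| - `|m| / 10 by rewrite subr_gt0.
pose I1 := [set x | `|x - x0| <= r]; pose I2 := [set y | `|y - y0| <= s].
have sub : A `&` I1 `<=` g @` (I2 `\` B).
  move=> x [Ax /= xr]; exists (h x); rewrite ?gh//; split => /=.
    apply: le_trans (ler_distD (h x0) _ _) _.
    have h1 := near_affine_on_le _ _ _ _ x0 x hh I I.
    have h2 := ler_wpM2l (ltW m0') xr.
    by rewrite /s; rewrite /s in hy; clear - h1 h2 hy mr; lra.
  by move=> Bh; apply: hn; exists x; split => //; exact: le_trans xr rrho.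
have gL' y y' : `|g y' - g y| <= (`|m| - `|m| / 10)^-1 * `|y' - y|.
  by rewrite mulrC; exact: gL.
have ki : 0 < (`|m| - `|m| / 10)^-1 by rewrite invr_gt0.
have u1 := hA r r0 rA.
have u2 : (lam (A `&` I1) <= (`|m| - `|m| / 10)^-1%:E * lam (I2 `\` B))%E.
  apply: le_trans (outer_measure_lipschitz_image g _ _ ki gL').
  exact: le_outer_measure.
have u3 : (((1 - 1 / 10) * (2 * s))%:E <= lam (I2 `&` B))%E.
  apply: le_trans (hB s s0 rB) _.
  by apply: le_outer_measure => y [[By _] Iy]; split.
(* Carathéodory's criterion for [B], tested on [I2]. *)
have u4 : ((2 * s)%:E = lam (I2 `&` B) + lam (I2 `\` B))%E.
  by rewrite -(outer_measure_closed_ball y0 s (ltW s0)); exact: (mB I2).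
have u5 : (lam (I2 `\` B) <= (2 * s / 10)%:E)%E.
  have f1 : lam (I2 `&` B) \is a fin_num.
    rewrite ge0_fin_numE ?outer_measure_ge0//.
    apply: (@le_lt_trans _ _ (lam I2)); first exact: le_outer_measure.
    by rewrite outer_measure_closed_ball ?ltry// ltW.
  rewrite -(@leeD2lE _ (lam (I2 `&` B)))// -u4.
  apply: le_trans (leeD2r _ u3).
  by rewrite -EFinD lee_fin; clear; lra.
have ki' : (0 <= (`|m| - `|m| / 10)^-1%:E)%E by rewrite lee_fin ltW.
(* The left side is [9 / 5 * r], while the right side is [(2 * s / 10) / (9 / 10 * |m|) = 4 / 9 *
   r]. *)
have := le_trans u1 (le_trans u2 (lee_wpmul2l ki' u5)).
rewrite -EFinM lee_fin ler_pdivlMl// => bad.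
by move: bad; apply/negP; rewrite -ltNge /s; clear - mr; lra.
Qed.

End OuterMeasure.

(** * Gaps, bridges and thickness *)

Definition reflect_set {R : realType} (K : set R) : set R := [set x | K (- x)].

                                                                                                
                                                                 
(** The working form of thickness at least [tau]: it compares a gap with any gap at least as long,
    and so avoids both the choice of the first such gap and the infimum. *)
Definition bridges_dominate {R : realType} (K : set R) (tau : R) :=
  forall a b c d, is_gap R K a b -> is_gap R K c d -> b - a <= d - c ->
  (b <= c -> tau * (b - a) <= c - b) /\ (d <= a -> tau * (b - a) <= a - d).

Section Gaps.
Context {R : realType}.
Implicit Types (K : set R).

Lemma is_gap_reflect K a b : is_gap R K a b -> is_gap R (reflect_set K) (- b) (- a).
Proof.
move=> [ab [Ka [Kb nK]]]; rewrite /is_gap /reflect_set /= !opprK ltrN2.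
split => //; split => //; split => // x bx xa.
by apply: nK; [rewrite ltrNr|rewrite ltrNl].
Qed.

Lemma reflect_setK K : reflect_set (reflect_set K) = K.
Proof. by apply/funext => x; rewrite /reflect_set /= opprK. Qed.

Lemma bridges_dominate_reflect K tau : bridges_dominate K tau ->
  bridges_dominate (reflect_set K) tau.
Proof.
move=> hK a b c d /is_gap_reflect; rewrite reflect_setK => gab.
move=> /is_gap_reflect; rewrite reflect_setK => gcd abcd.
have [|h1 h2] := hK _ _ _ _ gab gcd; first by clear - abcd; lra.
split=> [bc|da].
  have := h2; rewrite lerN2 => /(_ bc); clear; lra.
have := h1; rewrite lerN2 => /(_ da); clear; lra.
Qed.

Lemma gap_lt_separated K a b c d : is_gap R K a b -> is_gap R K c d -> a < c -> b <= c.
Proof.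
move=> [_ [_ [_ nK]]] [_ [Kc _]] ac; rewrite leNgt; apply/negP => cb.
exact: nK ac cb Kc.
Qed.

Lemma gap_eqr K a b d : is_gap R K a b -> is_gap R K a d -> b = d.
Proof.
move=> [ab [Ka [Kb nb]]] [ad [_ [Kd nd]]]; apply/eqP; rewrite eq_le !leNgt.
by apply/andP; split; apply/negP => h; [exact: nb h Kd|exact: nd h Kb].
Qed.

Lemma closed_reflect K : closed K -> closed (reflect_set K).
Proof.
have c : continuous (fun x : R => - x) by exact: opp_continuous.
by move/continuous_closedP: c; exact.
Qed.

Lemma closed_last_before K p x : closed K -> K p -> p <= x ->
  exists a, [/\ K a, p <= a, a <= x & forall y, K y -> y <= x -> y <= a].
Proof.
move=> cK Kp px; pose S := K `&` [set y | y <= x].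
have S0 : S !=set0 by exists p.
have Sub : has_ubound S by exists x => y [].
have : closure S (sup S) by exact: closure_sup.
have cS : closed S by apply: closedI => //; exact: closed_le.
move=> /cS [Ka ax]; exists (sup S); split => //.
  by apply: ub_le_sup => //; split.
by move=> y Ky yx; apply: ub_le_sup => //; split.
Qed.

Lemma gap_around K p x q : closed K -> K p -> K q -> p < x -> x < q -> ~ K x ->
  exists a b, [/\ is_gap R K a b, a < x, x < b, p <= a & b <= q].
Proof.
move=> cK Kp Kq px xq nKx.
have [a [Ka pa ax am]] := closed_last_before K p x cK Kp (ltW px).
have Kq' : reflect_set K (- q) by rewrite /reflect_set /= opprK.
have qx : - q <= - x by rewrite lerN2 ltW.
have [b [Kb qb bx bm]] := closed_last_before _ _ _ (closed_reflect K cK) Kq' qx.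
have neq y : K y -> y != x by move=> Ky; apply/eqP => yx; apply: nKx; rewrite -yx.
have ax' : a < x by rewrite lt_neqAle ax neq.
have xb' : x < - b by rewrite lt_neqAle eq_sym neq// lerNr.
exists a, (- b); split => //; last by rewrite lerNl.
split; first exact: lt_trans xb'.
do 2!split => //; move=> y ay yb Ky.
have [yx|xy] := leP y x; first by have := am y Ky yx; rewrite leNgt ay.
have := bm (- y); rewrite /reflect_set /= opprK lerN2 => /(_ Ky (ltW xy)).
by rewrite leNgt ltrNr yb.
Qed.

(** Left endpoints of gaps of length at least [l] are at least [l] apart, so a gap starting less
    than [l] above their infimum is already the first. *)
Lemma first_big_gap K b l c d : 0 < l -> is_gap R K c d -> b <= c -> l <= d - c ->
  exists c0 d0, [/\ is_gap R K c0 d0, b <= c0, l <= d0 - c0, c0 <= c &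
    forall c' d', is_gap R K c' d' -> b <= c' -> l <= d' - c' -> c0 <= c'].
Proof.
move=> l0 gcd bc ld.
pose S := [set c' | exists d', [/\ is_gap R K c' d', b <= c' & l <= d' - c']].
have Sc : S c by exists d.
have lbS : has_lbound S by exists b => y [? []].
have [|c0 [d0 [g0 bc0 l0']] c0l] := @inf_adherent R S l l0; first by split => //; exists c.
have min c' d' : is_gap R K c' d' -> b <= c' -> l <= d' - c' -> c0 <= c'.
  move=> g' bc' l'; rewrite leNgt; apply/negP => c'c0.
  have := gap_lt_separated _ _ _ _ _ g' g0 c'c0.
  have : inf S <= c' by apply: ge_inf => //; exists d'.
  by clear - l' c0l; lra.
by exists c0, d0; split => //; exact: min gcd bc ld.
Qed.

Lemma bridge_length_ge0 K a b L : compact K -> is_gap R K a b ->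
  right_bridge_length R K a b L \/ left_bridge_length R K a b L -> 0 <= L.
Proof.
move=> cK [ab [Ka [Kb _]]].
have [M [_ hM]] := compact_bounded cK.
have hM' x : K x -> `|x| <= M + 1 by apply: hM; rewrite ltrDl.
case=> [[[c [d [_ bc _ -> _]]]|[_ ->]]|[[c [d [_ da _ -> _]]]|[_ ->]]];
rewrite subr_ge0//.
  by apply: ub_le_sup => //; exists (M + 1) => y /hM'; apply: le_trans; exact: ler_norm.
by apply: ge_inf => //; exists (- (M + 1)) => y /hM'; rewrite ler_norml => /andP[].
Qed.

(** On the right, the bridge ends at the first long gap, which starts no later than [c]; its ratio
    bounds the infimum. The left side is the same argument for the reflected set. *)
Lemma thickness_bridges_dominate K : compact K -> bridges_dominate K (thickness R K).
Proof.
move=> cK a b c d gab gcd size; have [ab [Ka [Kb _]]] := gab.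
have ab0 : 0 < b - a by rewrite subr_gt0.
set T := [set r : R | exists a b L, is_gap R K a b /\
         (right_bridge_length R K a b L \/ left_bridge_length R K a b L) /\
         r = L / (b - a)].
have lbT : has_lbound T.
  exists 0 => r [a' [b' [L [gab' [hL ->]]]]]; have [ab' _] := gab'.
  by apply: divr_ge0; [exact: bridge_length_ge0 cK gab' hL|rewrite subr_ge0 ltW].
split=> [bc|da].
  have [c0 [d0 [g0 bc0 l0 c0c mc]]] := first_big_gap K b (b - a) c d ab0 gcd bc size.
  rewrite -ler_pdivlMr//; apply: (@le_trans _ _ ((c0 - b) / (b - a))).
    apply: ge_inf => //; exists a, b, (c0 - b); split => //; split => //.
    by left; left; exists c0, d0.
  by rewrite ler_pM2r ?invr_gt0// lerD2r.
have gcd' := is_gap_reflect _ _ _ gcd.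
have ad : - a <= - d by rewrite lerN2.
have size' : b - a <= - c - - d by clear - size; lra.
have [c0 [d0 [g0 bc0 l0 c0c mc]]] := first_big_gap _ (- a) (b - a) _ _ ab0 gcd' ad size'.
have g0' := is_gap_reflect _ _ _ g0; rewrite reflect_setK in g0'.
rewrite -ler_pdivlMr//; apply: (@le_trans _ _ ((a - (- c0)) / (b - a))).
  apply: ge_inf => //; exists a, b, (a - (- c0)); split => //; split => //.
  right; left; exists (- d0), (- c0); split => //.
  - by rewrite lerNl.
  - by clear - l0; lra.
  - move=> c' d' g' da' s'; rewrite lerNr.
    apply: (mc (- d') (- c')); first exact: is_gap_reflect.
      by rewrite lerN2.
    by clear - s'; lra.
by rewrite ler_pM2r ?invr_gt0//; clear - c0c; lra.
Qed.

Lemma finite_big_gaps K lo hi del : 0 < del -> finite_set [set u : R * R |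
  [/\ is_gap R K u.1 u.2, del <= u.2 - u.1, lo <= u.1 & u.2 <= hi]].
Proof.
move=> del0; set S := (X in finite_set X).
(* Distinct gaps have left endpoints at least [del] apart, so this integer part separates them. *)
pose f (u : R * R) := Num.truncn ((u.1 - lo) / del).
have f_inj : {in S &, injective f}.
  have wl (u v : R * R) : S u -> S v -> f u = f v -> ~ (u.1 < v.1).
    move=> [gu du lu uh] [gv dv lv vh] fuv uv.
    have sep := gap_lt_separated _ _ _ _ _ gu gv uv.
    have u0 : 0 <= (u.1 - lo) / del by rewrite divr_ge0 ?subr_ge0// ltW.
    have v0 : 0 <= (v.1 - lo) / del by rewrite divr_ge0 ?subr_ge0// ltW.
    have /andP[h1 _] := Num.Theory.truncn_itv u0.
    have /andP[_ h2] := Num.Theory.truncn_itv v0.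
    move: h1 h2; rewrite -/(f u) -/(f v) fuv -natr1 ler_pdivlMr// ltr_pdivrMr// => h1 h2.
    by clear - h1 h2 du sep; lra.
  move=> u v; rewrite !inE => Su Sv fuv.
  have [Eu Ev] : u.1 <= v.1 /\ v.1 <= u.1.
    by split; rewrite leNgt; apply/negP; [apply: wl|apply: wl].
  have E1 : u.1 = v.1 by apply/eqP; rewrite eq_le Eu.
  have E2 : u.2 = v.2.
    by move: Su Sv => [gu _ _ _] [gv _ _ _]; rewrite E1 in gu; exact: gap_eqr gu gv.
  by rewrite (surjective_pairing u) E1 E2 -surjective_pairing.
rewrite -(eq_finite_set (inj_card_eq f_inj)).
apply: (@sub_finite_set _ _ `I_(f (hi, hi)).+1); last exact: finite_II.
move=> _ [u [gu du lu uh] <-] /=; rewrite ltnS; apply: Num.Theory.le_truncn.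
rewrite ler_pM2r ?invr_gt0// lerD2r; apply: le_trans uh.
by have [/ltW] := gu.
Qed.

Lemma finite_set_argmin (T : choiceType) (S : set T) (phi : T -> R) : finite_set S ->
  S !=set0 -> exists2 x, S x & forall y, S y -> phi x <= phi y.
Proof.
move=> /finite_seqP[s ->]; elim: s => [[x]|x s IH _]; first by [].
have [[y ys]|n] := pselect (exists y, y \in s).
  have [|w ws hw] := IH; first by exists y.
  have [xw|wx] := leP (phi x) (phi w).
    exists x => [|v]; rewrite /= ?inE ?eqxx// => /orP[/eqP -> //|vs].
    exact: le_trans xw (hw v vs).
  exists w => [|v]; rewrite /= !inE; first by rewrite ws orbT.
  by move=> /orP[/eqP ->|/hw//]; exact: ltW.
exists x => [|v]; rewrite /= !inE ?eqxx// => /orP[/eqP -> //|vs].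
by case: n; exists v.
Qed.

(** Perfectness supplies a second point of [K] near [x]; total disconnectedness supplies a point
    outside [K] between the two, and the gap around it is small. *)
Lemma cantor_small_gap K x rho : cantor_set R K -> K x -> 0 < rho ->
  exists a b, [/\ is_gap R K a b, `|a - x| <= rho & `|b - x| <= rho].
Proof.
move=> [_ [cK [[clK lK] tdK]]] Kx rho0.
have : limit_point K x by rewrite lK.
move=> /(_ _ (nbhsx_ballx x rho rho0))[y [yx Ky]]; rewrite /ball/= => xy.
have [p [q [Kp Kq pq [px qx] hx]]] : exists p q, [/\ K p, K q, p < q,
    `|p - x| <= rho /\ `|q - x| <= rho & x = p /\ y = q \/ x = q /\ y = p].
  have xx : `|x - x| <= rho by rewrite subrr normr0 ltW.
  have yy : `|y - x| <= rho by rewrite distrC ltW.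
  have [xy'|yx'|e] := ltgtP x y.
  - by exists x, y; split => //; left.
  - by exists y, x; split => //; right.
  - by rewrite e eqxx in yx.
have [w [pw wq nKw]] : exists w, [/\ p < w, w < q & ~ K w].
  apply: contrapT => hn.
  have sub : `[p, q]%classic `<=` K.
    move=> w /=; rewrite in_itv/= !le_eqVlt => /andP[/orP[/eqP <- //|pw] /orP[/eqP -> //|wq]].
    by apply: contrapT => nw; apply: hn; exists w.
  have con : connected `[p, q]%classic by apply/connected_intervalP; exact: interval_is_interval.
  have inx : `[p, q]%classic x.
    by rewrite /= in_itv/=; case: hx => -[-> _]; rewrite lexx (ltW pq).
  have iny : `[p, q]%classic y.
    by rewrite /= in_itv/=; case: hx => -[_ ->]; rewrite lexx (ltW pq).
  have := connected_component_max inx sub con iny.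
  by rewrite (tdK x Kx) => /= e; rewrite e eqxx in yx.
have [a [b [g aw wb pa bq]]] := gap_around K p w q clK Kp Kq pw wq nKw.
exists a, b; split => //; rewrite ler_distl.
  move: px qx; rewrite !ler_distl => /andP[h1 h2] /andP[h3 h4].
  by clear - h1 h2 h3 h4 pa bq aw wb; apply/andP; split; lra.
move: px qx; rewrite !ler_distl => /andP[h1 h2] /andP[h3 h4].
by clear - h1 h2 h3 h4 pa bq aw wb; apply/andP; split; lra.
Qed.

Lemma perfect_point_right K a b e : perfect_set K -> is_gap R K a b -> 0 < e ->
  exists c, [/\ K c, b < c & c - b <= e].
Proof.
move=> [_ lK] [ab [Ka [Kb nK]]] e0.
have : limit_point K b by rewrite lK.
have m0 : 0 < Num.min e (b - a) by rewrite lt_min e0 subr_gt0.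
move=> /(_ _ (nbhsx_ballx b _ m0))[c [cb Kc]].
rewrite /ball/= distrC lt_min !ltr_distl => /andP[/andP[h1 h2] /andP[h3 h4]].
exists c; split => //; last by clear - h2; lra.
rewrite lt_neqAle eq_sym cb leNgt; apply/negP => c_b.
by apply: (nK c) => //; clear - h3; lra.
Qed.

Lemma perfect_point_left K a b e : perfect_set K -> is_gap R K a b -> 0 < e ->
  exists c, [/\ K c, c < a & a - c <= e].
Proof.
move=> [_ lK] [ab [Ka [Kb nK]]] e0.
have : limit_point K a by rewrite lK.
have m0 : 0 < Num.min e (b - a) by rewrite lt_min e0 subr_gt0.
move=> /(_ _ (nbhsx_ballx a _ m0))[c [cb Kc]].
rewrite /ball/= distrC lt_min !ltr_distl => /andP[/andP[h1 h2] /andP[h3 h4]].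
exists c; split => //; last by clear - h1; lra.
rewrite lt_neqAle cb leNgt; apply/negP => c_b.
by apply: (nK c) => //; clear - h4; lra.
Qed.

End Gaps.

(** * The gap lemma along a curve, and Cantor sets *)

Section GapLemma.
Context {R : realType}.

Lemma disjoint_graph_distance (A B : set R) h (a1 a2 b1 b2 : R) : closed A -> closed B ->
  continuous h -> (forall x, a1 <= x <= a2 -> A x -> ~ B (h x)) ->
  exists2 del : R, 0 < del & forall x y, a1 <= x <= a2 -> b1 <= y <= b2 ->
    A x -> B y -> del <= `|h x - y|.
Proof.
move=> cA cB ch hn.
pose K := (`[a1, a2]%classic `&` A) `*` (`[b1, b2]%classic `&` B).
have cK : compact K.
  by apply: compact_setX; apply: compact_closedI => //; exact: segment_compact.
pose f (p : R * R) : R := h p.1 - p.2.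
have cf : continuous f.
  move=> p; apply: cvgB; last exact: cvg_snd.
  by apply: (continuous_comp (f := fst) (g := h)); do ?[exact: cvg_fst|exact: ch].
have cfK : closed (f @` K).
  apply: compact_closed; first exact: norm_hausdorff.
  by apply: continuous_compact => //; exact: continuous_subspaceT.
have n0 : ~ (f @` K) 0.
  move=> [[x y] /= [[xa Ax] [_ By]]] /eqP; rewrite subr_eq0 => /eqP hxy.
  apply: (hn x _ Ax); last by rewrite hxy.
  by move: xa; rewrite /= in_itv.
have : nbhs (0 : R) (~` (f @` K)).
  by apply: open_nbhs_nbhs; split => //; exact: closed_openC.
move=> /nbhs_ballP[del /= del0 hdel]; exists del => // x y xa yb Ax By.
rewrite leNgt; apply/negP => lt; apply: (hdel (f (x, y))).
  by rewrite /ball/= sub0r normrN.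
by exists (x, y) => //; split; split => //=; rewrite in_itv.
Qed.

                                                                                               
                                                                                       
                                                                                           
                                                                                 
                                
(** Suppose the graph misses [A * B]. Call gaps [u] of [A] and [v] of [B] linked when the intervals
    [h(u)] and [v] overlap with neither containing the other. Linked pairs exist, and there are
    finitely many, so one has least total length. The thickness inequality makes either [h(u)]
    shorter than the bridges of [v], or [v] shorter than the images of the bridges of [u]. An
    endpoint of the shorter interval then lies in another gap of the other set, which is again
    linked and by minimality at least as long as the one it replaces. The bridge between these two
    gaps would fit inside the shorter interval, a contradiction. The outer gaps [(a0, a1)] and
    [(b2, b3)] act as the comparison gaps where this search could leave the window. *)
Lemma gap_lemma (A B : set R) (h : R -> R) (s1 s2 tA tB a0 a1 a2 b1 b2 b3 : R) :
  closed A -> closed B -> continuous h -> bijective h -> 0 < s1 -> 0 < s2 ->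
  (forall x x', x <= x' -> s1 * (x' - x) <= h x' - h x <= s2 * (x' - x)) ->
  bridges_dominate A tA -> bridges_dominate B tB -> 0 <= tB -> s2 < s1 * (tA * tB) ->
  is_gap R A a0 a1 -> A a2 -> a2 - a1 <= a1 - a0 ->
  is_gap R B b2 b3 -> B b1 -> b2 - b1 <= b3 - b2 ->
  b1 < h a1 -> h a1 < b2 -> b2 < h a2 ->
  exists x, [/\ a1 <= x, x <= a2, A x & B (h x)].
Proof.
move=> cA cB ch [g hK gK] s10 s20 hs thA thB tB0 s12 gA Aa2 ga2 gB Bb1 gb1 i1 i2 i3.
have [a01 [Aa0 [Aa1 _]]] := gA; have [b23 [Bb2 [Bb3 _]]] := gB.
have hle x x' : x <= x' -> h x <= h x'.
  move=> xx'; have /andP[k _] := hs _ _ xx'; rewrite -subr_ge0; apply: le_trans k.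
  by rewrite mulr_ge0 ?subr_ge0// ltW.
have hlt x x' : h x < h x' -> x < x'.
  by move=> k; rewrite ltNge; apply/negP => /hle; rewrite leNgt k.
have hltm x x' : x < x' -> h x < h x'.
  move=> xx'; have /andP[k _] := hs _ _ (ltW xx'); rewrite -subr_gt0; apply: lt_le_trans k.
  by rewrite mulr_gt0 ?subr_gt0.
apply: contrapT => hn.
have nB x : a1 <= x -> x <= a2 -> A x -> ~ B (h x).
  by move=> u v Ax Bx; apply: hn; exists x.
have nA y : h a1 <= y -> y <= h a2 -> B y -> ~ A (g y).
  move=> u v By Ay; apply: (nB (g y)) => //; last by rewrite gK.
    by rewrite leNgt; apply/negP => /hltm; rewrite gK ltNge u.
  by rewrite leNgt; apply/negP => /hltm; rewrite gK ltNge v.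
have nB' x : a1 <= x <= a2 -> A x -> ~ B (h x) by move=> /andP[u v]; exact: nB.
have [del del0 hdel] := disjoint_graph_distance A B h a1 a2 b1 b2 cA cB ch nB'.
pose GA := [set u : R * R |
  [/\ is_gap R A u.1 u.2, del / s2 <= u.2 - u.1, a1 <= u.1 & u.2 <= a2]].
pose GB := [set v : R * R |
  [/\ is_gap R B v.1 v.2, del <= v.2 - v.1, b1 <= v.1 & v.2 <= b2]].
have fin : finite_set (GA `*` GB).
  by apply: finite_setX; apply: finite_big_gaps => //; rewrite divr_gt0.
pose linked (u v : R * R) := [\/ [/\ h u.1 < v.1, v.1 < h u.2 & h u.2 < v.2] |
  [/\ v.1 < h u.1, h u.1 < v.2 & v.2 < h u.2]].
pose inA (u : R * R) := [/\ is_gap R A u.1 u.2, a1 <= u.1 & u.2 <= a2].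
pose inB (v : R * R) := [/\ is_gap R B v.1 v.2, b1 <= v.1 & v.2 <= b2].
(* The images of endpoints of [u] are at distance at least [del] from those of [v], so the overlap
   of a linked pair forces both gaps to be long. *)
have linkedG u v : inA u -> inB v -> linked u v -> (GA `*` GB) (u, v).
  move=> [gu au ua] [gv bv vb] luv.
  have [u12 [Au1 [Au2 _]]] := gu; have [v12 [Bv1 [Bv2 _]]] := gv.
  have u1r : a1 <= u.1 <= a2 by rewrite au (le_trans (ltW u12) ua).
  have u2r : a1 <= u.2 <= a2 by rewrite ua (le_trans au (ltW u12)).
  have v1r : b1 <= v.1 <= b2 by rewrite bv (le_trans (ltW v12) vb).
  have v2r : b1 <= v.2 <= b2 by rewrite vb (le_trans bv (ltW v12)).
  have d11 := hdel _ _ u1r v1r Au1 Bv1.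
  have d12 := hdel _ _ u1r v2r Au1 Bv2.
  have d21 := hdel _ _ u2r v1r Au2 Bv1.
  have d22 := hdel _ _ u2r v2r Au2 Bv2.
  have /andP[_ su] := hs _ _ (ltW u12).
  have [lu lv] : del <= h u.2 - h u.1 /\ del <= v.2 - v.1.
    case: luv => -[l1 l2 l3].
      move: d11; rewrite distrC gtr0_norm ?subr_gt0// => d11.
      move: d21; rewrite gtr0_norm ?subr_gt0// => d21.
      by split; [clear - d11 l2|clear - d21 l3]; lra.
    move: d12; rewrite distrC gtr0_norm ?subr_gt0// => d12.
    move: d11; rewrite gtr0_norm ?subr_gt0// => d11.
    by split; [clear - d12 l3|clear - d11 l2]; lra.
  split; split => //=; rewrite ler_pdivrMr// mulrC.
  exact: le_trans su.
(* Take the gap [v] of [B] around [h a1]; its right end is below [h a2], so the gap of [A] around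
   the preimage of that end is linked to it. *)
have ex0 : exists u v, [/\ inA u, inB v & linked u v].
  have aa : a1 < a2 by apply: hlt; exact: lt_trans i2 i3.
  have [v1 [v2 [gv v1h hv2 bv vb]]] := gap_around B b1 (h a1) b2 cB Bb1 Bb2 i1 i2
    (nB a1 (lexx _) (ltW aa) Aa1).
  have [v12 [Bv1 [Bv2 _]]] := gv.
  have v2a2 : v2 < h a2 by exact: le_lt_trans vb i3.
  have [u1 [u2 [gu u1g gu2 au ua]]] : exists a b, [/\ is_gap R A a b, a < g v2,
      g v2 < b, a1 <= a & b <= a2].
    apply: gap_around => //; [by apply: hlt; rewrite gK|by apply: hlt; rewrite gK|].
    by apply: nA => //; rewrite ltW.
  have [u12 [Au1 [Au2 _]]] := gu.
  have hu1 : h u1 < v2 by rewrite -(gK v2); exact: hltm.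
  have hu2 : v2 < h u2 by rewrite -(gK v2); exact: hltm.
  exists (u1, u2), (v1, v2); split => //.
  by right; split => //=; apply: lt_le_trans v1h _; exact: hle.
pose L := [set p : (R * R) * (R * R) | [/\ inA p.1, inB p.2 & linked p.1 p.2]].
have finL : finite_set L.
  by apply: sub_finite_set fin => -[u v] [/= iu iv luv]; exact: linkedG.
have L0 : L !=set0 by have [u [v H]] := ex0; exists (u, v).
pose phi (p : (R * R) * (R * R)) : R := (p.1.2 - p.1.1) + (p.2.2 - p.2.1).
have [[[u1 u2] [v1 v2]] [/= [/= gu au ua] [/= gv bv vb] luv] hmin] :=
  finite_set_argmin _ _ phi finL L0.
have [u12 [Au1 [Au2 _]]] := gu; have [v12 [Bv1 [Bv2 _]]] := gv.
have u0 : 0 < u2 - u1 by rewrite subr_gt0.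
have v0 : 0 < v2 - v1 by rewrite subr_gt0.
have newA u1' u2' : is_gap R A u1' u2' -> a1 <= u1' -> u2' <= a2 ->
    linked (u1', u2') (v1, v2) -> u2 - u1 <= u2' - u1'.
  move=> g' a' a'' l'.
  have := hmin ((u1', u2'), (v1, v2)); rewrite /phi /= lerD2r; apply.
  by split.
have newB v1' v2' : is_gap R B v1' v2' -> b1 <= v1' -> v2' <= b2 ->
    linked (u1, u2) (v1', v2') -> v2 - v1 <= v2' - v1'.
  move=> g' b' b'' l'.
  have := hmin ((u1, u2), (v1', v2')); rewrite /phi /= lerD2l; apply.
  by split.
have /andP[_ hus] := hs _ _ (ltW u12).
have hu12 := hltm _ _ u12.
(* If both failed, multiplying the inequalities would contradict [s2 < s1 * (tA * tB)]. *)
have dich : s2 * (u2 - u1) < tB * (v2 - v1) \/ v2 - v1 < s1 * (tA * (u2 - u1)).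
  apply: contrapT => /not_orP[/negP n1 /negP n2].
  rewrite -leNgt in n1; rewrite -leNgt in n2.
  have k1 := ler_wpM2l tB0 n2.
  have k2 : s2 * (u2 - u1) < s1 * (tA * tB) * (u2 - u1) by rewrite ltr_pM2r.
  by clear - n1 k1 k2; lra.
have hs1 x x' w : x <= x' -> tA * (u2 - u1) <= x' - x -> h x' - h x <= w ->
    w < s1 * (tA * (u2 - u1)) -> False.
  move=> xx' k1 k2 k3; have /andP[k4 _] := hs _ _ xx'.
  have k5 := ler_wpM2l (ltW s10) k1.
  by clear - k2 k3 k4 k5; lra.
case: luv => -[/= l1 l2 l3]; case: dich => dich.
- have hu1 : a1 <= u1 <= a2 by rewrite au (le_trans (ltW u12)).
  have [v1' [v2' [g' c1 c2 c3 c4]]] := gap_around B b1 (h u1) v1 cB Bb1 Bv1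
    (lt_le_trans i1 (hle _ _ au)) l1 (nB' u1 hu1 Au1).
  have size : v2 - v1 <= v2' - v1'.
    apply: newB => //; first exact: le_trans c4 (le_trans (ltW v12) vb).
    by right; split => //=; exact: le_lt_trans c4 l2.
  have [_ /(_ c4) br] := thB _ _ _ _ gv g' size.
  by clear - br dich hus c2 l2; lra.
- have v2a2 : v2 < h a2 by exact: le_lt_trans vb i3.
  have [u1' [u2' [g' c1 c2 c3 c4]]] : exists a b, [/\ is_gap R A a b, a < g v2,
      g v2 < b, u2 <= a & b <= a2].
    apply: gap_around => //; [by apply: hlt; rewrite gK|by apply: hlt; rewrite gK|].
    apply: nA => //; last exact: ltW.
    by apply: le_trans (hle _ _ au) _; apply: ltW; exact: lt_trans (lt_trans l1 l2) l3.
  have hu1 : h u1' < v2 by rewrite -(gK v2); exact: hltm.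
  have hu2 : v2 < h u2' by rewrite -(gK v2); exact: hltm.
  have size : u2 - u1 <= u2' - u1'.
    apply: newA => //; first exact: le_trans (le_trans au (ltW u12)) c3.
    by right; split => //=; apply: lt_le_trans l2 (hle _ _ c3).
  have [/(_ c3) br _] := thA _ _ _ _ gu g' size.
  apply: (hs1 u2 u1' (v2 - v1) c3 br _ dich).
  by clear - hu1 l2; lra.
(* Here [h u2] must first be shown to lie below [b2]: the gap [(b2, b3)] is at least as long as [v],
   so the bridge from [v2] to [b2] is longer than [h(u)]. *)
- have v1b1 : v2 - v1 <= b3 - b2 by clear - bv vb gb1; lra.
  have [/(_ vb) br _] := thB _ _ _ _ gv gB v1b1.
  have hub2 : h u2 < b2 by clear - br dich hus l2; lra.
  have hu2 : a1 <= u2 <= a2 by rewrite ua (le_trans au (ltW u12)).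
  have [v1' [v2' [g' c1 c2 c3 c4]]] := gap_around B v2 (h u2) b2 cB Bv2 Bb2
    l3 hub2 (nB' u2 hu2 Au2).
  have size : v2 - v1 <= v2' - v1'.
    apply: newB => //; first exact: le_trans bv (le_trans (ltW v12) c3).
    by left; split => //=; exact: lt_le_trans l2 c3.
  have [/(_ c3) br' _] := thB _ _ _ _ gv g' size.
  by clear - br' dich hus c1 l2; lra.
(* Likewise, the bridge between [a1] and [u1] given by the gap [(a0, a1)] forces [h a1 < v1]. *)
- have u1a1 : u2 - u1 <= a1 - a0 by clear - au ua ga2; lra.
  have [_ /(_ au) br] := thA _ _ _ _ gu gA u1a1.
  have hav1 : h a1 < v1.
    rewrite ltNge; apply/negP => k; apply: (hs1 a1 u1 (v2 - v1) au br _ dich).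
    by clear - k l2; lra.
  have [u1' [u2' [g' c1 c2 c3 c4]]] : exists a b, [/\ is_gap R A a b, a < g v1,
      g v1 < b, a1 <= a & b <= u1].
    apply: gap_around => //; [by apply: hlt; rewrite gK|by apply: hlt; rewrite gK|].
    apply: nA => //; first exact: ltW.
    by apply: le_trans (hle _ _ ua); apply: ltW; exact: lt_trans l1 hu12.
  have hu1 : h u1' < v1 by rewrite -(gK v1); exact: hltm.
  have hu2 : v1 < h u2' by rewrite -(gK v1); exact: hltm.
  have size : u2 - u1 <= u2' - u1'.
    apply: newA => //; first exact: le_trans c4 (le_trans (ltW u12) ua).
    by left; split => //=; apply: le_lt_trans (hle _ _ c4) l2.
  have [_ /(_ c4) br'] := thA _ _ _ _ gu g' size.
  apply: (hs1 u2' u1 (v2 - v1) c4 br' _ dich).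
  by clear - hu2 l2; lra.
Qed.

Lemma near_affine_gap_lemma (A B : set R) h (m eta tA tB a0 a1 a2 b1 b2 b3 : R) :
  closed A -> closed B -> near_affine_on setT m eta h -> 0 < eta -> eta < m ->
  bridges_dominate A tA -> bridges_dominate B tB -> 0 <= tB ->
  m + eta < (m - eta) * (tA * tB) ->
  is_gap R A a0 a1 -> A a2 -> a1 < a2 -> a2 - a1 <= a1 - a0 ->
  is_gap R B b2 b3 -> B b1 -> b1 < b2 -> b2 - b1 <= b3 - b2 ->
  b1 < h a1 -> h a1 < b2 -> b2 - h a1 < (m - eta) * (a2 - a1) ->
  exists x, [/\ a1 <= x, x <= a2, A x & B (h x)].
Proof.
move=> cA cB hh eta0 em thA thB tB0 ht gA Aa2 a12 ga2 gB Bb1 b12 gb1 i1 i2 i3.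
have m0 : 0 < m by exact: lt_trans eta0 em.
have [|g [gK hK _]] := near_affine_inverse m eta h hh eta0; first by rewrite gtr0_norm.
have hs x x' : x <= x' -> (m - eta) * (x' - x) <= h x' - h x <= (m + eta) * (x' - x).
  by move=> xx'; exact: near_affine_on_lt hh I I xx'.
have := gap_lemma A B h (m - eta) (m + eta) tA tB a0 a1 a2 b1 b2 b3; apply => //.
- exact: near_affine_continuous hh eta0.
- by exists g.
- by rewrite subr_gt0.
- by rewrite addr_gt0.
- by have /andP[k _] := hs _ _ (ltW a12); clear - k i3; lra.
Qed.

Lemma thickness_ge0 (K : set R) : compact K -> 0 <= thickness R K.
Proof.
move=> cK; rewrite /thickness; set T := (X in inf X).
have [T0|/set0P/negP/negPn/eqP ->] := pselect (T !=set0); last by rewrite inf0.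
apply: lb_le_inf => // r [a [b [L [gab [hL ->]]]]]; have [ab _] := gab.
by apply: divr_ge0; [exact: bridge_length_ge0 cK gab hL|rewrite subr_ge0 ltW].
Qed.

Lemma thickness_graph_stable (A B : set R) : cantor_set R A -> cantor_set R B ->
  1 < thickness R A * thickness R B ->
  exists x0 y0, (x0, y0) <> (0, 0) /\ graph_stable A B x0 y0.
Proof.
move=> hA hB tAB.
have [A0 [kA [[cA lA] _]]] := hA; have [B0 [kB [[cB lB] _]]] := hB.
set tA := thickness R A in tAB; set tB := thickness R B in tAB.
have thA : bridges_dominate A tA := thickness_bridges_dominate A kA.
have thB : bridges_dominate B tB := thickness_bridges_dominate B kB.
have tB0 : 0 <= tB := thickness_ge0 B kB.
set k := tA * tB in tAB.
have [x0 Ax0] := A0.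
have [y0 By0 y00] : exists2 y0, B y0 & y0 != 0.
  have [y By] := B0; have [yE|] := eqVneq y 0; last by exists y.
  have : limit_point B y by rewrite lB.
  by move=> /(_ setT filterT)[y0 [y0y By0 _]]; exists y0; rewrite -?yE.
exists x0, y0; split; first by case=> _ /eqP; rewrite (negbTE y00).
move=> m m0; have m0' : 0 < `|m| by rewrite normr_gt0.
have k1 : 0 < k - 1 by rewrite subr_gt0.
have k2 : 0 < 2 * (k + 1) by rewrite mulr_gt0// addr_gt0// (lt_trans _ tAB).
(* Half of the threshold at which [(|m| + eta) / (|m| - eta)] would reach [k]. *)
pose eta := `|m| * (k - 1) / (2 * (k + 1)).
have eta0 : 0 < eta by rewrite divr_gt0// mulr_gt0.
have etaE : 2 * (eta * k) + 2 * eta = `|m| * k - `|m|.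
  have : eta * (2 * (k + 1)) = `|m| * (k - 1) by rewrite /eta divfK// gt_eqF.
  by clear; lra.
have ek : 0 < eta * (k - 1) by rewrite mulr_gt0.
have em : eta < `|m|.
  rewrite /eta ltr_pdivrMr// ltr_pM2l//; clear - k1; lra.
have slope : `|m| + eta < (`|m| - eta) * k.
  have mk : 0 < `|m| * (k - 1) by rewrite mulr_gt0.
  by clear - etaE mk; lra.
exists eta => // rho rho0.
have rho2 : 0 < rho / 2 by rewrite divr_gt0.
have [a0 [a1 [gA _ a1x]]] := cantor_small_gap A x0 (rho / 2) hA Ax0 rho2.
have [a01 [Aa0 [Aa1 _]]] := gA.
have mA0 : 0 < Num.min (rho / 2) (a1 - a0) by rewrite lt_min rho2 subr_gt0.
have [a2 [Aa2 a12]] := perfect_point_right A a0 a1 _ (conj cA lA) gA mA0.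
rewrite le_min => /andP[a2r a2g].
have [c1 [c2 [gB c1y c2y]]] := cantor_small_gap B y0 (rho / 2) hB By0 rho2.
have [c12 [Bc1 [Bc2 _]]] := gB.
have mB0 : 0 < c2 - c1 by rewrite subr_gt0.
have close x : a1 <= x -> x <= a2 -> `|x - x0| <= rho.
  move: a1x; rewrite !ler_distl => /andP[? ?] ? ?; apply/andP; split; lra.
have s0 : 0 < (`|m| - eta) * (a2 - a1) by rewrite mulr_gt0// subr_gt0.
(* The centre is placed at height [c] from an endpoint of the gap of [B]. With tolerance [c / 2],
   [h a1] is between [c / 2] and [3 * c / 2] from this endpoint, hence short of the next chosen
   point of [B], and [h] passes the endpoint before [a2]. *)
have ex_c b : 0 < b -> exists c : R, [/\ 0 < c, 2 * c <= b, c <= rho / 2 &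
    2 * c <= (`|m| - eta) * (a2 - a1)].
  move=> b0; exists (Num.min (b / 2) (Num.min (rho / 2) ((`|m| - eta) * (a2 - a1) / 2))).
  split.
  - by rewrite !lt_min rho2 !divr_gt0.
  - by rewrite mulrC -ler_pdivlMr// ge_min lexx.
  - by rewrite !ge_min lexx orbT.
  - by rewrite mulrC -ler_pdivlMr// !ge_min lexx !orbT.
have [mpos|mneg] := ltP 0 m.
  rewrite (gtr0_norm mpos) in em slope s0 ex_c.
  have [b1 [Bb1 b12 b1g]] := perfect_point_left B c1 c2 _ (conj cB lB) gB mB0.
  have b10 : 0 < c1 - b1 by rewrite subr_gt0.
  have [c [c0 cb cr cs]] := ex_c _ b10.
  exists a1, (c1 - c), (c / 2); split.
  - by apply: close => //; exact: ltW.
  - move: c1y; rewrite !ler_distl => /andP[p q]; apply/andP; clear - p q c0 cr; split; lra.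
  - by rewrite divr_gt0.
  move=> h hh; rewrite ler_distl => /andP[h1 h2].
  have [|||x [u v Ax Bx]] := near_affine_gap_lemma A B h m eta tA tB a0 a1 a2 b1 c1 c2
    cA cB hh eta0 em thA thB tB0 slope gA Aa2 a12 a2g gB Bb1 b12 b1g.
  - by clear - h1 cb c0; lra.
  - by clear - h2 c0; lra.
  - by clear - h1 cs c0; lra.
  by exists x; split => //; exact: close.
have mneg' : m < 0 by rewrite lt_neqAle m0.
rewrite (ltr0_norm mneg') in em slope s0 ex_c.
have [b1 [Bb1 b12 b1g]] := perfect_point_right B c1 c2 _ (conj cB lB) gB mB0.
have b10 : 0 < b1 - c2 by rewrite subr_gt0.
have [c [c0 cb cr cs]] := ex_c _ b10.
exists a1, (c2 + c), (c / 2); split.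
- by apply: close => //; exact: ltW.
- move: c2y; rewrite !ler_distl => /andP[p q]; apply/andP; clear - p q c0 cr; split; lra.
- by rewrite divr_gt0.
move=> h hh; rewrite ler_distl => /andP[h1 h2].
(* A decreasing [h] is handled by applying the increasing case to [- h] and the reflection of
   [B]. *)
have Bb1' : reflect_set B (- b1) by rewrite /reflect_set /= opprK.
have b12' : - b1 < - c2 by rewrite ltrN2.
have b1g' : - c2 - - b1 <= - c1 - - c2 by clear - b1g; lra.
have [|||x [u v Ax]] := near_affine_gap_lemma A (reflect_set B) (fun x => - h x) (- m) eta
    tA tB a0 a1 a2 (- b1) (- c2) (- c1) cA (closed_reflect B cB) (near_affine_onN _ _ _ _ hh)
    eta0 em thA (bridges_dominate_reflect _ _ thB) tB0 slope gA Aa2 a12 a2g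
    (is_gap_reflect _ _ _ gB) Bb1' b12' b1g'.
- by clear - h2 cb c0; lra.
- by clear - h1 c0; lra.
- by clear - h2 cs c0; lra.
rewrite /reflect_set /= opprK => Bx.
by exists x; split => //; exact: close.
Qed.

End GapLemma.

Theorem mainTheorem1 (R : realType) (z : R -> R -> R)
  (hz : C2_plane R z)
  (hzy : forall x y : R, (x, y) <> (0, 0) -> pdy R z x y != 0)
  (A B : set R) (hA : Rbounded R A) (hB : Rbounded R B)
  (hcases :
     (positive_lebesgue_measure R A /\ positive_lebesgue_measure R B)
  \/ (cantor_set R A /\ cantor_set R B /\ thickness R A * thickness R B > 1)
  \/ (second_category R A /\ second_category R B /\ baire_set R B)
  \/ ((exists J1 : set R, nondegenerate_interval R J1 /\
         (J1 `\` A) #= [set: nat]) /\ B #= [set: R]))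
  (Gamma : set (R * R))
  (hG : contains_C2_curve_nonvanishing_curvature R Gamma) :
  interior (plane_sum R (Pset R z A B) Gamma) !=set0.
Proof.
have [x0 [y0 [xy0 AB]]] : exists x0 y0, (x0, y0) <> (0, 0) /\ graph_stable A B x0 y0.
  case: hcases => [[mA mB]|[[kA [kB tAB]]|[[sA [sB bB]]|[cA cB]]]].
  - exact: positive_measure_graph_stable.
  - exact: thickness_graph_stable.
  - exact: second_category_graph_stable.
  - exact: cocountable_graph_stable.
exact: graph_stable_interior hz (hzy _ _ xy0) hG AB.
Qed.
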